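(* Let $a,b\ge 2$ be relatively prime integers, and let $0<a',a''<a$ and $0<b',b''<b$ be the unique integers with $a'b-b'a=1$ and $b''a-a''b=1$. Assume that the zeta maps on $\mathfrak{D}_{a,b}$, $\mathfrak{D}_{a',b'}$ and $\mathfrak{D}_{a'',b''}$ are bijections. Let $Q$ be an $(a,b)$-Dyck path containing the lattice point at level $1$, i.e. the point $(b',a')$, and let $Q'\in\mathfrak{D}_{a',b'}$ and $Q''\in\mathfrak{D}_{a'',b''}$ be the two Dyck paths whose concatenation is $Q$. Then the bounded partition of $\chi(Q)$, drawn rotated by $180^\circ$ below the main diagonal of the $a\times b$ grid, is the one (i) whose restriction to the $a'\times b'$ rectangle $[0,b']\times[0,a']$ is the bounded partition of $\chi(Q')$ and whose restriction to the $a''\times b''$ rectangle $[b',b]\times[a',a]$ is the bounded partition of $\chi(Q'')$ (each drawn rotated by $180^\circ$ below the diagonal of the corresponding rectangle), and (ii) which, outside these two rectangles, contains all the unit boxes of the $a\times b$ grid lying below the main diagonal (and no others).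
   Context: For relatively prime positive integers $a,b$, an $(a,b)$-Dyck path is a lattice path from $(0,0)$ to $(b,a)$ with unit north steps and unit east steps, all of whose lattice points $(x,y)$ satisfy $ax\le by$; it is drawn in the grid with $a$ rows and $b$ columns. $\mathfrak{D}_{a,b}$ is the set of all of them. The level of a lattice point $(x,y)$ is $by-ax$. The main diagonal is the segment from $(0,0)$ to $(b,a)$. The partition bounded by a path is the partition whose Young diagram (English notation) is the set of boxes of the grid above (northwest of) the path. Rotating the grid by $180^\circ$ about its centre, this becomes a set of boxes in the southeast corner of the grid, lying below the main diagonal; this is what is meant by drawing the bounded partition rotated by $180^\circ$. Hooks and cores: the unit box with southeast corner $(x,y)$ has hook filling $by-ax$. The positive hooks of $P\in\mathfrak{D}_{a,b}$ are the positive hook fillings of the boxes of the grid lying below (southeast of) $P$. $\mathfrak{c}(P)$ is the partition whose set of first-column hook lengths is the set of positive hooks of $P$ (it has no hook length equal to $a$ or $b$). For a partition $\kappa$ and a positive integer $m$: consider the hook lengths of the boxes in the first column of $\kappa$; for each residue modulo $m$ that occurs take the largest such hook length; the rows of $\kappa$ with these first-column hook lengths are the $m$-rows. The $m$-boundary of $\kappa$ is the set of boxes with hook length less than $m$. Zeta: $\lambda(P)=(\lambda_1\ge\dots\ge\lambda_a)$ has as parts the numbers of $b$-boundary boxes in the $a$-rows of $\mathfrak{c}(P)$ (padded with zeros). $\zeta(P)$ is the $(a,b)$-Dyck path bounding $\lambda(P)$. Conjugation: $P^c$ is obtained by applying cyclic shifts to the step sequence of $P$ until a path lying strictly below the diagonal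 (except at its two endpoints) is obtained (there is exactly one such cyclic shift), and rotating this path by $180^\circ$. When $\zeta$ is a bijection, the conjugate-area map is $\chi(Q)=\zeta\big((\zeta^{-1}(Q))^c\big)$. The same definitions are used with $(a',b')$ and $(a'',b'')$ in place of $(a,b)$ (these pairs are also relatively prime). An $(a,b)$-Dyck path passing through $(b',a')$ (the lattice point of level $1$) is the concatenation of an $(a',b')$-Dyck path (from $(0,0)$ to $(b',a')$) and a translated $(a'',b'')$-Dyck path (from $(b',a')$ to $(b,a)$). *)

(* Defs.v *)
From mathcomp Require Import all_boot.
From mathcomp Require Import zify.

(* A lattice path starting at (0,0) is its sequence of steps:
   true is a unit north step, false is a unit east step.               *)

Definition lattice_point (p : seq bool) (k : nat) : nat * nat :=
  (count negb (take k p), count id (take k p)).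

Definition lattice_points (p : seq bool) : seq (nat * nat) :=
  [seq lattice_point p k | k <- iota 0 (size p).+1].

Definition dyck_paths (a b : nat) : {set (a + b).-tuple bool} :=
  [set p : (a + b).-tuple bool |
     (count id p == a) && all (fun c => a * c.1 <= b * c.2) (lattice_points p)].

(* x-coordinates of the north steps, from bottom to top.  When p ends at (b, a),
   the unit box [x, x + 1] x [y, y + 1] of the grid is above (northwest of) p iff
   x < nth 0 (north_steps p) y. *)
Fixpoint north_steps_from (x : nat) (p : seq bool) : seq nat :=
  match p with
  | [::] => [::]
  | true :: p' => x :: north_steps_from x p'
  | false :: p' => north_steps_from x.+1 p'
  end.

Definition north_steps (p : seq bool) : seq nat := north_steps_from 0 p.

(* Row lengths from top to bottom, including zeros; this has one entry per row
   of the grid. *)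
Definition bounded_partition (p : seq bool) : seq nat := rev (north_steps p).

(* In an a x b grid the English Young diagram of lam has its box of row r and
   column c (from 0) at [c, c + 1] x [a - 1 - r, a - r]; the rotation by 180 degrees
   about the centre of the grid sends it to [b - 1 - c, b - c] x [r, r + 1].
   The pair (x, y) stands for the unit box with southwest corner (x, y). *)
Definition rotated_diagram (a b : nat) (lam : seq nat) : pred (nat * nat) :=
  [pred c : nat * nat | [&& c.1 < b, c.2 < a & b - 1 - c.1 < nth 0 lam c.2]].

(* The northwest corner of the box is on or below the line from (0,0) to (b,a). *)
Definition below_diagonal (a b : nat) : pred (nat * nat) :=
  [pred c : nat * nat | b * c.2.+1 <= a * c.1].

(* A partition is the sequence of its row lengths; rows and columns are numbered
   from 0. *)

Definition column_length (kap : seq nat) (j : nat) : nat :=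
  count (fun r => j < r) kap.

Definition hook_length (kap : seq nat) (i j : nat) : nat :=
  (nth 0 kap i - j.+1) + (column_length kap j - i.+1) + 1.

Definition first_column_hooks (kap : seq nat) : seq nat :=
  [seq hook_length kap i 0 | i <- iota 0 (size kap)].

(* The box with southwest corner (x, y) has southeast corner (x + 1, y). *)
Definition positive_hooks (a b : nat) (p : seq bool) : seq nat :=
  [seq b * c.2 - a * c.1.+1
     | c <- [seq (x, y) | x <- iota 0 b, y <- iota 0 a]
     & (nth 0 (north_steps p) c.2 <= c.1) && (a * c.1.+1 < b * c.2)].

(* For h_0 > ... > h_(k-1) the row lengths are h_i - (k - 1 - i); see
   first_column_hooks_core. *)
Definition partition_of_hooks (h : seq nat) : seq nat :=
  [seq nth 0 h i - (size h - 1 - i) | i <- iota 0 (size h)].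

Definition core (a b : nat) (p : seq bool) : seq nat :=
  partition_of_hooks (sort geq (positive_hooks a b p)).

Definition modular_rows (m : nat) (kap : seq nat) : seq nat :=
  [seq i <- iota 0 (size kap) |
     all (fun h => (h == hook_length kap i 0 %[mod m])
                     ==> (h <= hook_length kap i 0))
         (first_column_hooks kap)].

Definition boundary_boxes (m : nat) (kap : seq nat) (i : nat) : nat :=
  count (fun j => hook_length kap i j < m) (iota 0 (nth 0 kap i)).

Definition zeta_partition (a b : nat) (p : seq bool) : seq nat :=
  let kap := core a b p in
  let s := sort geq [seq boundary_boxes b kap i | i <- modular_rows a kap] in
  s ++ nseq (a - size s) 0.

(* The path that has only east steps, which is not a Dyck path for a > 0, is used
   as the default value: if some zeta_partition were not bounded by a Dyck path,
   zeta would not map dyck_paths a b to itself. *)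
Definition zeta (a b : nat) (p : (a + b).-tuple bool) : (a + b).-tuple bool :=
  odflt [tuple of nseq (a + b) false]
    [pick q : (a + b).-tuple bool in dyck_paths a b
       | bounded_partition q == zeta_partition a b p].

Definition zeta_bijective (a b : nat) : Prop :=
  {in dyck_paths a b &, injective (zeta a b)} /\
  zeta a b @: dyck_paths a b = dyck_paths a b.

(* The preimage of q when zeta is a bijection. *)
Definition zeta_inv (a b : nat) (q : (a + b).-tuple bool) : (a + b).-tuple bool :=
  odflt q [pick p : (a + b).-tuple bool in dyck_paths a b | zeta a b p == q].

Definition strictly_below (a b : nat) (p : seq bool) : bool :=
  all (fun k => b * (lattice_point p k).2 < a * (lattice_point p k).1)
      (iota 1 (a + b - 1)).

(* Rotating a path by 180 degrees reverses its step sequence. *)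
Definition conjugate (a b : nat) (p : (a + b).-tuple bool) : (a + b).-tuple bool :=
  let k := find (fun i => strictly_below a b (rot i p)) (iota 0 (a + b)) in
  [tuple of rev (rot k p)].

Definition chi (a b : nat) (q : (a + b).-tuple bool) : (a + b).-tuple bool :=
  zeta a b (conjugate a b (zeta_inv a b q)).

Lemma nth_partition_of_hooks h i : i < size h ->
  nth 0 (partition_of_hooks h) i = nth 0 h i - (size h - 1 - i).
Proof.
by move=> hi; rewrite /partition_of_hooks (nth_map 0) ?size_iota // nth_iota.
Qed.

Lemma sorted_gtn_nth h i : sorted gtn h -> all (leq 1) h -> i < size h ->
  size h - 1 - i < nth 0 h i.
Proof.
elim: h i => [|x h IH] //= i px /andP[x0 ph].
have sh : sorted gtn h by exact: path_sorted px.
case: i => [|i] /= hi; last by have := IH i sh ph hi; lia.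
case: h px ph IH sh {hi} => [|y h] /=; first by lia.
by move=> /andP[xy _] ph IH sh; have := IH 0 sh ph isT => /=; lia.
Qed.

Lemma first_column_partition_of_hooks h : sorted gtn h -> all (leq 1) h ->
  first_column_hooks (partition_of_hooks h) = h.
Proof.
move=> sh ph; have sz : size (partition_of_hooks h) = size h.
  by rewrite size_map size_iota.
have cl : column_length (partition_of_hooks h) 0 = size h.
  rewrite -[RHS]sz; apply/eqP; rewrite -all_count; apply/(all_nthP 0) => i.
  rewrite sz => hi; rewrite nth_partition_of_hooks //.
  by have := sorted_gtn_nth _ _ sh ph hi; lia.
apply: (@eq_from_nth _ 0); rewrite size_map size_iota ?sz // => i hi.
rewrite /first_column_hooks sz (nth_map 0) ?size_iota // nth_iota //.
rewrite add0n /hook_length cl.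
rewrite nth_partition_of_hooks //.
by have := sorted_gtn_nth _ _ sh ph hi; lia.
Qed.

Lemma first_column_hooks_core a b (p : seq bool) : 0 < a -> coprime a b ->
  first_column_hooks (core a b p) = sort geq (positive_hooks a b p).
Proof.
move=> a0 co; apply: first_column_partition_of_hooks; last first.
  rewrite all_sort; apply/allP => _ /mapP[c + ->].
  by rewrite mem_filter => /andP[/andP[_ +] _]; lia.
rewrite gtn_sorted_uniq_geq sort_uniq sort_sorted ?andbT; last first.
  by move=> x y; exact: leq_total.
rewrite map_inj_in_uniq; last first.
  have row c : c \in [seq (x, y) | x <- iota 0 b, y <- iota 0 a] -> c.2 < a.
    by move=> /allpairsP[d [_ + ->]]; rewrite mem_iota.
  move=> [x y] [u v]; rewrite !mem_filter.
  move=> /andP[/andP[_ /= h1] /row /= y1] /andP[/andP[_ /= h2] /row /= y2] e.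
  have key : forall s t, s < a -> t < a -> s <= t -> forall w z,
      b * t + a * w = b * s + a * z -> s = t.
    move=> s t sa ta st w z E.
    have : a %| b * (t - s).
      by apply/dvdnP; exists (z - w); rewrite mulnBl mulnBr; lia.
    rewrite Gauss_dvdr // => /dvdn_leq; lia.
  have E : b * y + a * u.+1 = b * v + a * x.+1 by move: h1 h2 e; rewrite /=; lia.
  have yv : y = v.
    case: (leqP v y) => H; first by apply/esym/(key v y) => //; exact: E.
    by apply: (key y v) => //; [exact: ltnW | exact: esym E].
  subst; congr (_, _); apply/eqP.
  by rewrite -eqSS -(eqn_pmul2l a0); apply/eqP; move: E; lia.
rewrite filter_uniq // allpairs_uniq ?iota_uniq //.
by move=> [? ?] [? ?] _ _.
Qed.

(* Main.v *)
Require Import Defs.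
From mathcomp Require Import all_boot all_order all_algebra.
From mathcomp Require Import zify.
Import Order.TTheory GRing.Theory Num.Theory.

(** Every step of an (a, b)-Dyck path departs from a lattice point and arrives at
    the next one, and only the order of the levels of these points matters.  The
    parts of the zeta partition of P are, for each north step, the number of east
    steps that depart from a lower level ([zeta_partitionE]); for the conjugate
    of P they are, for each north step, the number of east steps that arrive at
    a higher level than it does ([conjugate_zeta_partition]).

    Let P' and P'' be the preimages of Q' and Q'' under zeta.  Cut P' at its
    highest point, which a north step reaches, and insert P'' there, to get an
    (a, b)-path P.  As b' level = b level' + x and b'' level = b level'' - x, with
    abscissas x that are small compared to b, the order of the levels inside P'
    and inside P'' is the same in P as before.  The point (b'', a'') has level
    -1, so the part of P' after the insertion goes down by one level.  Hence all
    the points from which a step of P' departs are below those from which a step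
    of P'' departs, and the sweep of P is the sweep of P' followed by the sweep of
    P'': zeta P is the concatenation of Q' and Q'', that is Q
    ([insertion_zeta]).  Since zeta is injective, P is the preimage of Q.

    For the arrivals there is one difference.  The north step into the highest
    point of P' now arrives at the lowest level of P'', and the last east step of
    P'' arrives just below, at the highest level of P'.  So the partition of the
    conjugate of P has the rows of the conjugate of P', lengthened by b'' except
    for the last one, which is 0 and becomes b'' - 1, followed by the rows of the
    conjugate of P'' ([insertion_conjugate_lengths]).  In the rotated picture the
    lengthened rows fill the rectangle southeast of both smaller rectangles, apart
    from the box with northwest corner (b', a').  This corner has level 1, so this
    is the only box of that rectangle that is not below the diagonal. *)

(** * Steps and levels of a lattice path *)

Notation origin := (0%N, 0%N).

Definition step (s : bool) (c : nat * nat) : nat * nat :=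
  if s then (c.1, c.2.+1) else (c.1.+1, c.2).

Definition endpoint (c : nat * nat) (p : seq bool) : nat * nat :=
  (c.1 + count negb p, c.2 + count id p).

(** The points at which the steps equal to [s] start, in the order of the path.
    Sorting the steps of a path by the levels of these points, or of the points
    where they end, is all that zeta and conjugation depend on. *)
Fixpoint departures (s : bool) (c : nat * nat) (p : seq bool) : seq (nat * nat) :=
  match p with
  | [::] => [::]
  | t :: p' => (if t == s then [:: c] else [::]) ++ departures s (step t c) p'
  end.

Definition arrivals (s : bool) (c : nat * nat) (p : seq bool) : seq (nat * nat) :=
  [seq step s d | d <- departures s c p].

Definition level (a b : nat) (c : nat * nat) : int :=
  (Posz (b * c.2) - Posz (a * c.1))%R.

Lemma endpoint_cat c p q : endpoint c (p ++ q) = endpoint (endpoint c p) q.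
Proof. by rewrite /endpoint !count_cat !addnA. Qed.

Lemma endpoint_cons c s p : endpoint c (s :: p) = endpoint (step s c) p.
Proof. by case: s; rewrite /endpoint /= ?addnS ?addSn. Qed.

Lemma endpoint0 c : endpoint c [::] = c.
Proof. by case: c => x y; rewrite /endpoint !addn0. Qed.

Lemma endpoint_rcons c p s : endpoint c (rcons p s) = step s (endpoint c p).
Proof. by rewrite -cats1 endpoint_cat endpoint_cons endpoint0. Qed.

Lemma departures_cat s c p q :
  departures s c (p ++ q) = departures s c p ++ departures s (endpoint c p) q.
Proof.
elim: p c => [|t p IH] c /=; first by rewrite endpoint0.
by rewrite IH endpoint_cons catA.
Qed.

Lemma arrivals_cat s c p q :
  arrivals s c (p ++ q) = arrivals s c p ++ arrivals s (endpoint c p) q.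
Proof. by rewrite /arrivals departures_cat map_cat. Qed.

Definition translate (u c : nat * nat) : nat * nat := (c.1 + u.1, c.2 + u.2).

Lemma step_translate s u c : step s (translate u c) = translate u (step s c).
Proof. by case: s. Qed.

Lemma departures_translate s u c p :
  departures s (translate u c) p = [seq translate u d | d <- departures s c p].
Proof.
elim: p c => [|t p IH] c //=.
by rewrite step_translate IH map_cat; case: eqP.
Qed.

Lemma arrivals_translate s u c p :
  arrivals s (translate u c) p = [seq translate u d | d <- arrivals s c p].
Proof.
rewrite /arrivals departures_translate -!map_comp.
by apply: eq_map => d /=; rewrite step_translate.
Qed.

Lemma translate0 u : translate u origin = u.
Proof. by case: u. Qed.

Lemma mem_departures s c p d : d \in departures s c p ->
  exists p1 p2, p = p1 ++ s :: p2 /\ d = endpoint c p1.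
Proof.
elim: p c => [|t p IH] c //=; rewrite mem_cat => /orP[|/IH[p1 [p2 [-> ->]]]].
  case: eqP => // -> /[!inE] /eqP ->.
  by exists [::], p; rewrite endpoint0.
by exists (t :: p1), p2; rewrite endpoint_cons.
Qed.

Lemma mem_arrivals s c p d : d \in arrivals s c p ->
  exists p1 p2, p = rcons p1 s ++ p2 /\ d = endpoint c (rcons p1 s).
Proof.
case/mapP => e /mem_departures[p1 [p2 [-> ->]]] ->.
by exists p1, p2; rewrite cat_rcons endpoint_rcons.
Qed.

Lemma level_step a b s c :
  level a b (step s c) = (level a b c + if s then Posz b else - Posz a)%R.
Proof. by case: s; rewrite /level /=; lia. Qed.

Lemma level_translate a b u c :
  level a b (translate u c) = (level a b c + level a b u)%R.
Proof. by rewrite /level /=; lia. Qed.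

Lemma endpoint_translate u p : endpoint u p = translate u (endpoint origin p).
Proof. by rewrite /endpoint /translate /= !add0n; congr (_, _); lia. Qed.

Lemma unzip1_departures x y p :
  [seq d.1 | d <- departures true (x, y) p] = north_steps_from x p.
Proof.
by elim: p x y => [|[] p IH] x y //=; rewrite IH.
Qed.

(** There is exactly one north step in each row of the grid; with its abscissa
    (the entry of [north_steps]) this locates it. *)
Lemma unzip2_departures x y p :
  [seq d.2 | d <- departures true (x, y) p] = iota y (count id p).
Proof.
by elim: p x y => [|[] p IH] x y //=; rewrite IH.
Qed.

Lemma unzip1_east_arrivals x y p :
  [seq d.1 | d <- arrivals false (x, y) p] = iota x.+1 (count negb p).
Proof.
by rewrite /arrivals -map_comp; elim: p x y => [|[] p IH] x y //=; rewrite IH.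
Qed.

Lemma size_departures s c p : size (departures s c p) = count (pred1 s) p.
Proof. by elim: p c => [|t p IH] c //=; rewrite size_cat IH; case: eqP. Qed.

Lemma count_steps p : count id p + count negb p = size p.
Proof. exact: (count_predC id). Qed.

Definition is_dyck (a b : nat) (p : seq bool) : Prop :=
  endpoint origin p = (b, a) /\
  forall p1 p2, p = p1 ++ p2 -> (0 <= level a b (endpoint origin p1))%R.

Lemma dyckP a b (p : (a + b).-tuple bool) :
  reflect (is_dyck a b p) (p \in dyck_paths a b).
Proof.
rewrite inE; apply: (iffP andP) => [[/eqP ca /allP D]|[e D]].
  split.
    rewrite /endpoint ca; have := count_steps p.
    by rewrite size_tuple ca => /addnI ->.
  move=> p1 p2 E.
  have : lattice_point p (size p1) \in lattice_points p.
    apply: map_f; rewrite mem_iota add0n ltnS E size_cat; lia.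
  by move/D; rewrite /lattice_point E take_size_cat // /level /endpoint /=; lia.
have [e1 e2] := e; split; first by apply/eqP; move: e2; rewrite /= add0n.
apply/allP => _ /mapP[k _ ->].
have := D (take k p) (drop k p); rewrite cat_take_drop => /(_ erefl).
by rewrite /level /endpoint /lattice_point /=; lia.
Qed.

Lemma size_dyck a b p : is_dyck a b p -> size p = a + b.
Proof. by move=> [[e1 e2] _]; rewrite -count_steps; lia. Qed.

(** Coprimality makes the level injective on the grid, up to the two ends of
    the diagonal: a difference of two points of equal level is a multiple of
    (b, a). *)
Lemma level_inj a b c d : 0 < b -> coprime a b -> level a b c = level a b d ->
  c.1 <= b -> c.2 <= a -> d.1 <= b -> d.2 <= a ->
  c = d \/ (c = origin /\ d = (b, a)) \/ (c = (b, a) /\ d = origin).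
Proof.
case: c d => [x y] [u v] b0 co; rewrite /level /=.
wlog xu : x y u v / x <= u.
  move=> W E h1 h2 h3 h4; case: (leqP x u) => H; first exact: W.
  have [] := W u v x y (ltnW H) (esym E) h3 h4 h1 h2; first by move=> ->; left.
  by case=> -[-> ->]; right; [right | left].
move=> E h1 h2 h3 h4.
have yv : b * (v - y) = a * (u - x) by rewrite !mulnBr; nia.
have co' : coprime b a by rewrite coprime_sym.
have : b %| u - x by rewrite -(Gauss_dvdr _ co') -yv dvdn_mulr.
have : a %| v - y by rewrite -(Gauss_dvdr _ co) yv dvdn_mulr.
case: (posnP (u - x)) => [z _ _|p0 _ /(dvdn_leq p0) le].
  left; have xu' : x = u by lia.
  by subst; congr (_, _); nia.
right; left; have [? ?] : x = 0 /\ u = b by lia.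
by subst; split; congr (_, _); nia.
Qed.

(** * Hook lengths in a row of a partition *)

(** As the rows decrease, those longer than [j] are the first ones. *)
Lemma column_length_gt kap j r : sorted geq kap ->
  (j < nth 0 kap r) = (r < column_length kap j).
Proof.
elim: kap r => [|x kap IH] r px; first by rewrite nth_nil.
rewrite /column_length /= -/(column_length kap j).
case: r => [|r] /=.
  case: (ltnP j x) => // xj; symmetry; apply: negbTE; rewrite -leqNgt leqn0.
  rewrite -/(column_length kap j) /column_length eqn0Ngt -has_count -all_predC.
  apply/allP => y yk /=; rewrite -leqNgt; apply: leq_trans xj.
  have := order_path_min _ px => /(_ (fun _ _ _ h1 h2 => leq_trans h2 h1)).
  by move/allP/(_ _ yk).
have := IH r (path_sorted px); case: (ltnP j x) => // xj ->.
have -> : column_length kap j = 0; last by lia.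
apply/eqP; rewrite /column_length eqn0Ngt -has_count -all_predC.
apply/allP => y yk /=; rewrite -leqNgt; apply: leq_trans xj.
have := order_path_min _ px => /(_ (fun _ _ _ h1 h2 => leq_trans h2 h1)).
by move/allP/(_ _ yk).
Qed.

Lemma sorted_partition_of_hooks h : sorted gtn h -> all (leq 1) h ->
  sorted geq (partition_of_hooks h).
Proof.
move=> sh ph; apply/(sortedP 0) => i; rewrite size_map size_iota => hi.
rewrite !nth_partition_of_hooks ?(ltnW hi) //.
have := sorted_gtn_nth _ _ sh ph hi.
by have := sortedP 0 sh i hi; rewrite /=; lia.
Qed.

(** In a row whose first-column hook length is n, the hook lengths are the
    differences n - g where g runs over the numbers below n that are not
    first-column hook lengths.  The column j corresponds to
    g = j + (number of rows of length at most j), whatever the row is; these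
    numbers avoid the first-column hook lengths, and there are as many of them
    as there are numbers to be found. *)
Lemma row_hooks_complement m h i : sorted gtn h -> all (leq 1) h -> i < size h ->
  boundary_boxes m (partition_of_hooks h) i =
  count (fun g => (g \notin h) && (nth 0 h i < g + m)) (iota 0 (nth 0 h i)).
Proof.
move=> sh ph hi; set kap := partition_of_hooks h; set n := nth 0 h i.
have skap : size kap = size h by rewrite size_map size_iota.
have so := sorted_partition_of_hooks _ sh ph.
have cl j r : (j < nth 0 kap r) = (r < column_length kap j).
  exact: column_length_gt.
have clk j : column_length kap j <= size h by rewrite -skap; exact: count_size.
have hk r : r < size h -> nth 0 h r = nth 0 kap r + (size h - 1 - r).
  move=> hr; rewrite nth_partition_of_hooks //.
  by have := sorted_gtn_nth _ _ sh ph hr; lia.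
(* [f j] is the non-hook that corresponds to the column [j]. *)
pose f j := j + (size h - column_length kap j).
have clm j j' : j <= j' -> column_length kap j' <= column_length kap j.
  by move=> jj; apply: sub_count => x /=; lia.
have finj : injective f.
  move=> j j'; have := clk j; have := clk j'; rewrite /f.
  by case: (leqP j j') => [|/ltnW] /[dup] /clm; lia.
have fh j : f j \notin h.
  (* Here and below, [change] restates a goal over [nat] itself, not over its eqType
     structure, as the arithmetic requires. *)
  apply/negP => /(nthP 0)[r]; change (r < size h -> nth 0 h r = f j -> False) => hr e.
  have := hk r hr; rewrite e /f; have := clk j; have := cl j r.
  by case: (ltnP r); case: (ltnP j); lia.
have hook j : j < nth 0 kap i -> hook_length kap i j + f j = n.
  move=> ji; rewrite /hook_length /n (hk i) //.
  by have := clk j; have := cl j i; rewrite ji /f => /esym; lia.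
have ki : nth 0 kap i = n - (size h - 1 - i) by rewrite nth_partition_of_hooks.
have un : uniq h by move: sh; rewrite gtn_sorted_uniq_geq => /andP[].
have P : perm_eq [seq f j | j <- iota 0 (nth 0 kap i)] [seq g <- iota 0 n | g \notin h].
  have us : uniq [seq f j | j <- iota 0 (nth 0 kap i)].
    by rewrite map_inj_uniq ?iota_uniq.
  have ss : {subset [seq f j | j <- iota 0 (nth 0 kap i)] <=
                    [seq g <- iota 0 n | g \notin h]}.
    move=> _ /mapP[j + ->]; rewrite !mem_iota mem_filter fh mem_iota /= add0n => ji.
    by have := hook j ji; rewrite /hook_length; lia.
  have [|_ eqi] := uniq_min_size us ss.
    rewrite size_map size_iota ki size_filter.
    have : size (drop i.+1 h) <= size [seq g <- iota 0 n | g \in h].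
      apply: uniq_leq_size; first exact: drop_uniq.
      move=> g /(nthP 0)[r].
      change (r < size (drop i.+1 h) -> nth 0 (drop i.+1 h) r = g ->
              g \in [seq g <- iota 0 n | g \in h]).
      rewrite size_drop nth_drop => hr <-.
      rewrite mem_filter mem_nth ?mem_iota ?add0n /=; last by lia.
      have tr : transitive gtn by move=> x y z /= h1 h2; exact: ltn_trans h2 h1.
      by apply: (sorted_ltn_nth tr 0 sh); rewrite ?inE; lia.
    rewrite size_drop size_filter => c1.
    have c2 : count (fun g : nat => g \in h) (iota 0 n)
              + count (fun g : nat => g \notin h) (iota 0 n) = n.
      by rewrite -[RHS](size_iota 0 n) -(count_predC (mem h)).
    change (is_true (size h - i.+1 <= count (fun g : nat => g \in h) (iota 0 n))) in c1.
    change (is_true (count (fun g : nat => g \notin h) (iota 0 n) <= n - (size h - 1 - i))).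
    lia.
  by apply: uniq_perm; rewrite ?filter_uniq ?iota_uniq.
transitivity (count (fun g => n < g + m) [seq f j | j <- iota 0 (nth 0 kap i)]).
  rewrite count_map; apply: eq_in_count => j; rewrite mem_iota /= add0n => ji.
  by have := hook j ji; lia.
rewrite (permP P) count_filter; apply: eq_count => g /=; exact: andbC.
Qed.

(** * Positive hooks and levels of north steps *)

Lemma north_departures p d : d \in departures true origin p ->
  d.2 < count id p /\ nth 0 (north_steps p) d.2 = d.1.
Proof.
move=> dp; have := map_f snd dp; rewrite unzip2_departures mem_iota add0n => d2.
split=> //; rewrite /north_steps -(unzip1_departures 0 0 p).
have [i hi e] := nthP origin dp.
have ei : d.2 = i.
  have := nth_map origin 0 snd hi; rewrite unzip2_departures e => <-.
  have : i < count id p by rewrite -(size_iota 0 (count id p)) -(unzip2_departures 0) size_map.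
  by move/(nth_iota 0 0) => ->.
by rewrite ei (nth_map origin) // e.
Qed.

Lemma mem_north_departures p y : y < count id p ->
  (nth 0 (north_steps p) y, y) \in departures true origin p.
Proof.
move=> hy; have : y \in [seq d.2 | d <- departures true origin p].
  by rewrite unzip2_departures mem_iota.
case/mapP => d dp ->; have [_ ->] := north_departures _ _ dp.
by rewrite -surjective_pairing.
Qed.

(** Below the path, the hook fillings of a row decrease by a from right after
    the north step of that row: they are l - a, l - 2a, ... where l is the level
    at which this step departs. *)
Lemma positive_hooksP a b p g : is_dyck a b p ->
  reflect (0 < g /\ exists2 d, d \in departures true origin p
             & exists j, level a b d = Posz (g + a * j.+1))
    (g \in positive_hooks a b p).
Proof.
move=> [[_ ca] _]; rewrite /= add0n in ca.
apply: (iffP mapP) => [[[x y]]|[g0 [d dp [j e]]]].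
  rewrite mem_filter /= => /andP[/andP[h1 h2]].
  case/allpairsP => -[u v] /= [+ + [? ?]]; subst u v.
  rewrite !mem_iota /= !add0n => xb ya ->; split; first by lia.
  exists (nth 0 (north_steps p) y, y); first by apply: mem_north_departures; rewrite ca.
  set n := nth 0 (north_steps p) y in h1 *.
  have e : a * x.+1 = a * n + a * (x - n).+1 by rewrite -mulnDr; congr muln; lia.
  by exists (x - n); rewrite /level /=; lia.
case: d dp e => x y dp e; have [/= y_lt nx] := north_departures _ _ dp.
have e' : b * y = g + a * (x + j).+1 by move: e; rewrite /level /=; lia.
exists (x + j, y); last by rewrite /=; lia.
rewrite mem_filter /= nx leq_addr e' /=; apply/andP; split; first by lia.
apply/allpairsP; exists (x + j, y); rewrite !mem_iota /= !add0n.
by split=> //; nia.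
Qed.

(** The rows 0, ..., a - 1 have the levels b y modulo a, so the north steps
    depart from each residue class modulo a exactly once. *)
Lemma north_departure_residue a b p d d' k : coprime a b -> is_dyck a b p ->
  d \in departures true origin p -> d' \in departures true origin p ->
  level a b d = (level a b d' + Posz a * k)%R -> d = d'.
Proof.
move=> co [[_ ca] _] dp dp' e; rewrite /= add0n in ca.
case: d d' dp dp' e => x y [x' y'] dp dp'; rewrite /level /= => e.
have [/= ya nx] := north_departures _ _ dp.
have [/= ya' nx'] := north_departures _ _ dp'.
suff yy : y = y' by rewrite -nx -nx' yy.
have low : forall s t l, s < a -> s <= t -> t < a ->
    (Posz (b * (t - s)) = Posz a * l)%R -> s = t.
  move=> s t l sa st ta E.
  have : (Posz a %| Posz (b * (t - s)))%Z by rewrite E dvdz_mulr.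
  rewrite dvdzE /= Gauss_dvdr //.
  case: (posnP (t - s)) => [|p0 /(dvdn_leq p0)]; lia.
case: (leqP y y') => [le|/ltnW le]; [|symmetry];
  [apply: (low y y' (Posz x' - Posz x - k)%R)|apply: (low y' y (Posz x - Posz x' + k)%R)];
  by rewrite ?mulnBr; have := leq_mul (leqnn b) le; lia.
Qed.

Lemma north_departure_exists a b p g : 0 < a -> coprime a b -> is_dyck a b p ->
  exists2 d, d \in departures true origin p
    & exists k, level a b d = (g + Posz a * k)%R.
Proof.
move=> a0 co [[_ ca] _]; rewrite /= add0n in ca.
have [r r_lt [q gq]] : exists2 r, r < a & exists q, g = (Posz r + Posz a * q)%R.
  exists `|(g %% Posz a)%Z|%N.
    by have := ltz_mod g (_ : Posz a != 0%R); have := modz_ge0 g (_ : Posz a != 0%R); lia.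
  exists (g %/ Posz a)%Z; have := divz_eq g (Posz a).
  by have := modz_ge0 g (_ : Posz a != 0%R); lia.
have [z zb] : exists z, b * z = r %[mod a].
  (* The Chinese remainder theorem inverts [b] modulo [a]. *)
  have /dvdnP[z e] : b %| chinese a b r 0.
    by rewrite /dvdn chinese_modr // mod0n.
  by exists z; rewrite mulnC -e chinese_modl.
exists (nth 0 (north_steps p) (z %% a), z %% a).
  by apply: mem_north_departures; rewrite ca ltn_mod.
move: zb; rewrite -modnMmr (modn_small r_lt).
set y := z %% a; set n := nth 0 _ _ => ry.
exists (Posz (b * y %/ a) - Posz n - q)%R.
by rewrite gq /level /= {1}(divn_eq (b * y) a) ry; lia.
Qed.

(** [g] lies in the class of [level c] modulo [a], and not below it.  When [c] is
    where a north step departs, this says that [g] is outside the arithmetic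
    progression of hooks of that row. *)
Definition above_class (a b : nat) (g : int) (c : nat * nat) : bool :=
  (level a b c <= g)%R && (Posz a %| (g - level a b c)%R)%Z.

(** Follow the indicator of [above_class g] along the path: a north step turns
    it into the indicator for [g - b], and an east step changes it only when it
    arrives at level [g].  Summing these changes gives the identity, and for a
    closed path the two end terms cancel. *)
Lemma above_class_telescope a b c p g : 0 < a ->
  count (above_class a b g) (departures true c p) + above_class a b g (endpoint c p)
  = count (above_class a b (g - Posz b)%R) (departures true c p)
    + count (fun d => level a b d == g) (arrivals false c p) + above_class a b g c.
Proof.
move=> a0; elim: p c => [|[] p IH] c; rewrite ?endpoint_cons ?endpoint0 //=.
  have := IH (step true c); rewrite /=.
  have -> : above_class a b g (step true c) = above_class a b (g - Posz b)%R c.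
    rewrite /above_class (level_step _ _ true).
    by congr andb; [lia | congr (_ \in dvdz _); lia].
  by rewrite /arrivals /=; lia.
have := IH (step false c); rewrite /=.
suff -> : above_class a b g (step false c)
   = above_class a b g c + (level a b (step false c) == g) :> nat by rewrite /arrivals /=; lia.
rewrite /above_class (level_step _ _ false).
have -> : (Posz a %| (g - (level a b c - Posz a))%R)%Z = (Posz a %| (g - level a b c)%R)%Z.
  have -> : (g - (level a b c - Posz a) = Posz a + (g - level a b c))%R by lia.
  by rewrite GRing.rpredDl ?dvdzz.
case: dvdzP => [[q e]|nd]; rewrite ?andbT ?andbF.
  (* level c <= g and level c - a <= g differ only if g = level c - a, q = -1. *)
  have [q2|[q1|q0]] : (q <= -2 \/ q = -1 \/ 0 <= q)%R by lia.
  - have : (q * Posz a <= - Posz a - Posz a)%R by nia.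
    by lia.
  - by move: e; rewrite q1; lia.
  - have : (0 <= q * Posz a)%R by nia.
    by lia.
by case: eqP => // e; case: nd; exists (-1)%R; lia.
Qed.

Lemma dyck_departure_ge0 a b p s d : is_dyck a b p ->
  d \in departures s origin p -> (0 <= level a b d)%R.
Proof.
by move=> [_ D] /mem_departures[p1 [p2 [e ->]]]; exact: (D _ _ e).
Qed.

Lemma dyck_arrival_ge0 a b p s d : is_dyck a b p ->
  d \in arrivals s origin p -> (0 <= level a b d)%R.
Proof.
by move=> [_ D] /mem_arrivals[p1 [p2 [e ->]]]; exact: (D _ _ e).
Qed.

Lemma uniq_north_departures p : uniq (departures true origin p).
Proof. by apply: (@map_uniq _ _ snd); rewrite unzip2_departures iota_uniq. Qed.

(** Every residue class contains the progression of exactly one row, so a number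
    that is not a hook is at least the level of the north step in its class.  The
    number 0 is no hook either, because of the step that departs from the
    origin. *)
Lemma not_positive_hook a b p g : 0 < a -> coprime a b -> is_dyck a b p ->
  (g \notin positive_hooks a b p) = has (above_class a b (Posz g)) (departures true origin p).
Proof.
move=> a0 co D; apply/idP/hasP => [gH|[d dp /andP[le /dvdzP[q e]]]]; last first.
  apply/positive_hooksP => // -[g0 [d' dp' [j e']]].
  have dd : d = d'.
    apply: (north_departure_residue _ _ _ _ _ (- (q + Posz j + 1))%R co D dp dp').
    by lia.
  by subst d'; nia.
have [d dp [k e]] := north_departure_exists _ _ _ (Posz g) a0 co D.
have dvd x : (level a b x = Posz g + Posz a * k)%R -> (Posz a %| (Posz g - level a b x)%R)%Z.
  by move=> ->; apply/dvdzP; exists (- k)%R; lia.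
have [le|gt] := lerP (level a b d) (Posz g).
  by exists d => //; rewrite /above_class le dvd.
case: (posnP g) => [g0|g0]; last first.
  case/negP: gH; apply/positive_hooksP => //; split=> //; exists d => //.
  have k0 : (0 < k)%R by nia.
  by exists `|k - 1|%N; nia.
have [d' dp' z] : exists2 d', d' \in departures true origin p & level a b d' = 0%R.
  have ca : 0 < count id p by case: (D) => -[_ ]; rewrite /= add0n => ->.
  have := mem_north_departures p 0 ca; set n := nth 0 _ _ => np.
  exists (n, 0) => //; have := dyck_departure_ge0 _ _ _ _ _ D np.
  by rewrite /level /=; lia.
exists d' => //; rewrite /above_class z g0 lexx.
by apply/dvdzP; exists 0%R.
Qed.

Lemma count_above_class a b p g : 0 < a -> coprime a b -> is_dyck a b p ->
  count (above_class a b g) (departures true origin p)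
  = has (above_class a b g) (departures true origin p) :> nat.
Proof.
move=> a0 co D; set L := departures _ _ _; rewrite has_count.
case: (posnP (count _ L)) => [-> //|c0]; have := c0; rewrite -has_count => /hasP[d dL ud].
suff : count (above_class a b g) L <= 1 by lia.
have <- : count_mem d L = 1 by rewrite count_uniq_mem ?uniq_north_departures // dL.
rewrite -!size_filter; apply: uniq_leq_size.
  by rewrite filter_uniq // uniq_north_departures.
move=> x; rewrite !mem_filter => /andP[ux xL]; rewrite xL andbT /=.
move: ud ux => /andP[_ /dvdzP[q e]] /andP[_ /dvdzP[q' e']].
by apply/eqP/(north_departure_residue _ _ _ _ _ (q - q')%R co D xL dL); lia.
Qed.

(** The recurrence behind the zeta map: the set of non-hooks is closed under
    adding [b], and the first non-hooks of the classes modulo [b] are the levels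
    at which the east steps arrive. *)
Lemma hooks_recurrence a b p g : 0 < a -> 0 < b -> coprime a b -> is_dyck a b p ->
  (g \notin positive_hooks a b p : nat)
  = ((b <= g) && (g - b \notin positive_hooks a b p))
    + count (fun e => level a b e == Posz g) (arrivals false origin p).
Proof.
move=> a0 b0 co D; have [e _] := D.
have := above_class_telescope a b origin p (Posz g) a0.
rewrite !count_above_class // e -not_positive_hook //.
have -> : above_class a b (Posz g) (b, a) = above_class a b (Posz g) origin.
  by rewrite /above_class /level /= !muln0 [b * a]mulnC !GRing.subrr.
move=> /addIn ->; congr addn.
case: leqP => [le|lt].
  rewrite not_positive_hook //=; congr (nat_of_bool (has (above_class a b _) _)).
  by lia.
case: hasP => // -[d /(dyck_departure_ge0 _ _ _ _ _ D) d0 /andP[]]; lia.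
Qed.

Lemma count_non_hooks a b p h : 0 < a -> 0 < b -> coprime a b -> is_dyck a b p ->
  count (fun g : nat => g \notin positive_hooks a b p) (iota 0 h)
  = count (fun g : nat => g \notin positive_hooks a b p) (iota 0 (h - b))
    + count (fun e => (level a b e < Posz h)%R) (arrivals false origin p).
Proof.
move=> a0 b0 co D; set N := fun g : nat => _.
elim: h => [|h IH].
  rewrite sub0n /= (eq_in_count (a2 := pred0)) ?count_pred0 // => e.
  by move/(dyck_arrival_ge0 _ _ _ _ _ D) => /=; lia.
have split1 s : count (fun e => (level a b e < Posz h.+1)%R) s =
    count (fun e => (level a b e < Posz h)%R) s + count (fun e => level a b e == Posz h) s.
  by elim: s => //= e s ->; lia.
rewrite -addn1 iotaD count_cat IH /= addn0 add0n {2}/N hooks_recurrence // addn1 split1.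
case: (leqP b h) => bh /=; last by rewrite (_ : h.+1 - b = h - b); lia.
by rewrite subSn // -addn1 iotaD count_cat /= /N addn0 add0n addnACA.
Qed.

(** For a hook [h] the difference of the two counts in [count_non_hooks] is taken
    over the window from [h - b] to [h].  If [h - b] is not negative then it is a
    hook as well, so the strict bound on the hook lengths loses nothing. *)
Lemma count_row a b p h : 0 < a -> 0 < b -> coprime a b -> is_dyck a b p ->
  h \in positive_hooks a b p ->
  count (fun g => (g \notin positive_hooks a b p) && (h < g + b)) (iota 0 h)
  = count (fun e => (level a b e < Posz h)%R) (arrivals false origin p).
Proof.
move=> a0 b0 co D hH; have := count_non_hooks _ _ _ h a0 b0 co D.
have hb : h - b <= h by lia.
rewrite -{1 5}(subnKC hb) !iotaD !count_cat add0n => /addnI <-.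
rewrite [X in X + _](eq_in_count (a2 := pred0)) ?count_pred0; last first.
  by move=> g; rewrite mem_iota /=; lia.
rewrite add0n; apply: eq_in_count => g; rewrite mem_iota => gi.
case: (boolP (h < g + b)) => [|hg]; first by rewrite andbT.
have [ge bh] : g = h - b /\ b <= h by lia.
have := hooks_recurrence a b p h a0 b0 co D.
rewrite hH bh ge /=; case: (_ \notin _) => //=; lia.
Qed.

(** * Zeta as a sweep of the departures *)

Lemma perm_eq_map_in (T : eqType) (U : eqType) (f g : T -> U) (s : seq T) :
  {in s, f =1 g} -> perm_eq (map f s) (map g s).
Proof. by move/eq_in_map => ->. Qed.

Lemma sort_geq_eq s t : sorted geq s -> perm_eq s t -> s = sort geq t.
Proof.
move=> so pe; apply: (@sorted_eq _ geq) => //.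
- by move=> x y z /= h1 h2; exact: leq_trans h2 h1.
- by move=> x y /=; rewrite -eqn_leq => /eqP ->.
- by apply: sort_sorted => x y; exact: leq_total.
by rewrite perm_sym perm_sort perm_sym.
Qed.

Lemma sorted_geq_cat s t : sorted geq s -> sorted geq t ->
  (forall x y, x \in s -> y \in t -> y <= x) -> sorted geq (s ++ t).
Proof.
case: s => [|x s] //= ps st st_le; rewrite cat_path ps /=.
case: t st st_le => [|y t] //= -> st_le; rewrite andbT.
by apply: st_le; [exact: mem_last | exact: mem_head].
Qed.

Lemma sorted_sort_geq s : sorted geq (sort geq s).
Proof. by apply: sort_sorted => x y; exact: leq_total. Qed.

Lemma uniq_positive_hooks a b p : 0 < b -> coprime a b -> uniq (positive_hooks a b p).
Proof.
move=> b0 co; rewrite map_inj_in_uniq; last first.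
  have grid c : c \in [seq (x, y) | x <- iota 0 b, y <- iota 0 a] -> c.1 < b /\ c.2 < a.
    by case/allpairsP => -[x y] /= []; rewrite !mem_iota => xb ya ->.
  move=> [x y] [u v]; rewrite !mem_filter => /= /andP[/andP[_ h1] /grid[/= xb ya]].
  move=> /andP[/andP[_ h2] /grid[/= ub va]] e.
  have [] := level_inj a b (x.+1, y) (u.+1, v) b0 co; rewrite /level /=; try lia.
    by case=> -> ->.
  by case=> -[].
by rewrite filter_uniq // allpairs_uniq ?iota_uniq // => -[? ?] [? ?].
Qed.

(** The rows of the core are indexed by its first-column hooks, so the a-rows are
    the hooks that are largest in their class modulo [a]. *)
Lemma modular_row_lengths a b p : 0 < a -> 0 < b -> coprime a b -> is_dyck a b p ->
  [seq boundary_boxes b (core a b p) i | i <- modular_rows a (core a b p)] =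
  [seq count (fun e => (level a b e < Posz h)%R) (arrivals false origin p)
     | h <- sort geq (positive_hooks a b p)
     & all (fun h' => (h' == h %[mod a]) ==> (h' <= h)) (positive_hooks a b p)].
Proof.
move=> a0 b0 co D; set H := positive_hooks a b p; set hs := sort geq H.
have fch : first_column_hooks (core a b p) = hs by exact: first_column_hooks_core.
have mhs g : (g \in hs) = (g \in H) by rewrite mem_sort.
have posH : all (leq 1) hs.
  by apply/allP => g; rewrite mhs => /(positive_hooksP _ _ _ _ D)[].
have szc : size (core a b p) = size hs by rewrite size_map size_iota.
have hk i : i < size hs -> hook_length (core a b p) i 0 = nth 0 hs i.
  by move=> hi; rewrite -fch (nth_map 0) ?size_iota ?szc // nth_iota ?szc.
set mx := fun h => all _ _; set F := fun h => count _ _.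
transitivity [seq F h | h <- [seq nth 0 hs i | i <- iota 0 (size hs)] & mx h].
  rewrite filter_map -map_comp /modular_rows szc fch.
  rewrite (eq_in_filter (a2 := preim (nth 0 hs) mx)); last first.
    move=> i; rewrite mem_iota add0n => /= hi; rewrite hk // /mx.
    by apply: eq_all_r => g; rewrite mhs.
  apply/eq_in_map => i; rewrite mem_filter mem_iota add0n => /and3P[_ _ hi] /=.
  have sg : sorted gtn hs.
    by rewrite gtn_sorted_uniq_geq sort_uniq uniq_positive_hooks // sorted_sort_geq.
  rewrite /core row_hooks_complement // /F -count_row ?mem_nth //.
    by apply: eq_count => g; rewrite mhs.
  by rewrite -mhs mem_nth.
by rewrite -[in RHS](mkseq_nth 0 hs).
Qed.

(** The largest hook of the row where a north step departs at level l is l - a,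
    provided l > a; distinct rows are in distinct classes. *)
Lemma maximal_hooks a b p : 0 < a -> 0 < b -> coprime a b -> is_dyck a b p ->
  perm_eq [seq h <- sort geq (positive_hooks a b p)
             | all (fun h' => (h' == h %[mod a]) ==> (h' <= h)) (positive_hooks a b p)]
    [seq (`|level a b d| - a)%N | d <- departures true origin p & (Posz a < level a b d)%R].
Proof.
move=> a0 b0 co D; set H := positive_hooks a b p; set N := departures true _ p.
have eqd := north_departure_residue _ _ _ _ _ _ co D.
apply: uniq_perm.
- by rewrite filter_uniq // sort_uniq uniq_positive_hooks.
- rewrite map_inj_in_uniq ?filter_uniq ?uniq_north_departures // => d d'.
  rewrite !mem_filter => /andP[gt dN] /andP[gt' dN'] e.
  by apply: (eqd _ _ 0%R dN dN'); lia.
move=> h; rewrite mem_filter mem_sort; apply/andP/mapP => [[/allP mx hH]|[d]].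
  have [h0 [d dN [j e]]] := positive_hooksP _ _ _ _ D hH.
  have gt : (Posz a < level a b d)%R by nia.
  exists d; first by rewrite mem_filter gt.
  have dH : `|level a b d| - a \in H.
    apply/(positive_hooksP _ _ _ _ D); split; first by lia.
    by exists d => //; exists 0; lia.
  have e1 : `|level a b d| - a = j * a + h by lia.
  have := mx _ dH; rewrite /= e1 modnMDl eqxx /=; nia.
rewrite mem_filter => /andP[gt dN] ->.
have dH : `|level a b d| - a \in H.
  apply/(positive_hooksP _ _ _ _ D); split; first by lia.
  by exists d => //; exists 0; lia.
split=> //; apply/allP => h' hH'; apply/implyP => /eqP em.
have [h0 [d' dN' [j e]]] := positive_hooksP _ _ _ _ D hH'.
have ed : d' = d.
  have := divn_eq h' a; have := divn_eq (`|level a b d| - a) a; rewrite em => e1 e2.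
  apply: (eqd _ _ (Posz (h' %/ a) - Posz ((`|level a b d| - a) %/ a) + Posz j)%R dN' dN).
  by lia.
by subst d'; nia.
Qed.

Lemma east_departure_ge a b p e : is_dyck a b p ->
  e \in departures false origin p -> (Posz a <= level a b e)%R.
Proof.
move=> D eE; have := dyck_arrival_ge0 _ _ _ _ _ D (map_f (step false) eE).
by rewrite level_step; lia.
Qed.

(** Zeta as a sweep map.  The north steps that depart from levels at most [a]
    have no hook in their row; they account for the zeros of the padding, since
    east steps depart from levels at least [a]. *)
Lemma zeta_partitionE a b p : 0 < a -> 0 < b -> coprime a b -> is_dyck a b p ->
  zeta_partition a b p =
  sort geq [seq count (fun e => (level a b e < level a b d)%R) (departures false origin p)
           | d <- departures true origin p].
Proof.
move=> a0 b0 co D; set N := departures true _ p; set E := departures false _ p.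
rewrite /zeta_partition modular_row_lengths //.
set s := map _ _; set G := fun d => count _ E.
pose P d := (Posz a < level a b d)%R.
have sG : perm_eq s [seq G d | d <- N & P d].
  apply: perm_trans (perm_map _ (maximal_hooks _ _ _ a0 b0 co D)) _.
  rewrite -map_comp; apply: perm_eq_map_in => d; rewrite mem_filter /P => /andP[gt _] /=.
  rewrite /G /arrivals count_map; apply: eq_count => e /=.
  by rewrite (level_step _ _ false); lia.
have G0 : [seq G d | d <- N & ~~ P d] = nseq (count (predC P) N) 0.
  rewrite -size_filter -(size_map G); apply/all_pred1P/allP => _ /mapP[d + ->] /=.
  rewrite mem_filter /P => /andP[le _]; rewrite /G.
  rewrite (eq_in_count (a2 := pred0)) ?count_pred0 // => e /(east_departure_ge _ _ _ _ D) /=.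
  by lia.
have szN : size N = a.
  rewrite size_departures (eq_count (a2 := id)); last by case.
  by case: D => -[_]; rewrite /= add0n.
have -> : a - size (sort geq s) = count (predC P) N.
  by rewrite size_sort (perm_size sG) size_map size_filter -szN -(count_predC P) addKn.
apply: sort_geq_eq.
  apply: sorted_geq_cat; first exact: sorted_sort_geq.
    by elim: (count _ N) => // -[|n] //= ->.
  by move=> x y _; rewrite mem_nseq => /andP[_ /eqP ->].
have <- := permPr (perm_map G (permEl (perm_filterC P N))).
by rewrite map_cat G0 perm_cat2r perm_sort.
Qed.

(** * Conjugation as a sweep of the arrivals *)

Lemma max_prefix (a b : nat) (p : seq bool) :
  exists p1 p2, p = p1 ++ p2 /\ forall q1 q2, p = q1 ++ q2 ->
    (level a b (endpoint origin q1) <= level a b (endpoint origin p1))%R.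
Proof.
pose f k := level a b (endpoint origin (take k p)).
have [k [kp mk]] : exists k, k <= size p /\ forall j, j <= size p -> (f j <= f k)%R.
  elim: (size p) => [|n [k [kn mk]]].
    by exists 0; split=> // j; rewrite leqn0 => /eqP ->.
  have [le|/ltW le] := lerP (f n.+1) (f k); [exists k | exists n.+1];
    split; rewrite ?(leqW kn) // => j; rewrite leq_eqVlt => /orP[/eqP -> //|/mk //].
  by move/le_trans; apply.
exists (take k p), (drop k p); rewrite cat_take_drop; split=> // q1 q2 e.
have := mk (size q1); rewrite /f {1 2}e size_cat leq_addr take_size_cat //.
by apply.
Qed.

Lemma level0 a b : level a b origin = 0%R.
Proof. by rewrite /level /= !muln0. Qed.

Lemma level_end a b : level a b (b, a) = 0%R.
Proof. by rewrite /level /= mulnC subrr. Qed.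

Lemma level_endpoint_cat a b p q : level a b (endpoint origin (p ++ q)) =
  (level a b (endpoint origin p) + level a b (endpoint origin q))%R.
Proof. by rewrite endpoint_cat endpoint_translate level_translate addrC. Qed.

(** Starting the cycle at a point of maximal level puts every other point below
    the diagonal; coprimality makes this strict. *)
Lemma strictly_below_rot a b p : 0 < b -> coprime a b -> is_dyck a b p ->
  exists2 k, k < a + b & strictly_below a b (rot k p).
Proof.
move=> b0 co D; have sp := size_dyck _ _ _ D.
have [p1 [p2 [e mx]]] := max_prefix a b p.
have sb : strictly_below a b (p2 ++ p1).
  apply/allP => i; rewrite mem_iota => /andP[i0 ilt].
  set q := take i (p2 ++ p1).
  have szq : size q = i.
    by rewrite size_take size_cat addnC -size_cat -e sp; case: ltnP; lia.
  have le0 : (level a b (endpoint origin q) <= 0)%R.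
    have ep : (level a b (endpoint origin p1) + level a b (endpoint origin p2) = 0)%R.
      by rewrite -level_endpoint_cat -e; case: D => -> _; rewrite level_end.
    rewrite /q take_cat; case: ltnP => hi.
      have := mx (p1 ++ take i p2) (drop i p2); rewrite -catA cat_take_drop => /(_ e).
      by rewrite level_endpoint_cat; lia.
    rewrite level_endpoint_cat.
    have := mx (take (i - size p2) p1) (drop (i - size p2) p1 ++ p2).
    by rewrite catA cat_take_drop => /(_ e); lia.
  have q12 := count_steps q; rewrite szq in q12.
  have lq : count id q <= a /\ count negb q <= b.
    have qp P : count P q <= count P p.
      rewrite e count_cat addnC -count_cat -(cat_take_drop i (p2 ++ p1)) count_cat.
      exact: leq_addr.
    by case: D => -[<- <-] _; rewrite /= !add0n.
  have [//|] := ltnP (b * count id q) (a * count negb q) => ge.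
  have l0 : level a b (endpoint origin q) = level a b origin.
    by move: le0; rewrite level0 /level /endpoint /=; lia.
  have [] := level_inj _ _ _ _ b0 co l0; rewrite /endpoint /=; try lia.
    by case; lia.
  by case=> -[[]] *; lia.
(* A maximum at the end of the path is also one at its start. *)
have [le|lt] := leqP (a + b) (size p1).
  exists 0; first by lia.
  rewrite rot0; suff -> : p = p2 ++ p1 by [].
  have /size0nil p20 : size p2 = 0 by have := size_cat p1 p2; rewrite -e sp; lia.
  by rewrite e p20 cats0.
by exists (size p1) => //; rewrite e rot_size_cat.
Qed.

Lemma is_dyck_rev a b q : endpoint origin q = (b, a) -> strictly_below a b q ->
  is_dyck a b (rev q).
Proof.
move=> eq sb; split.
  by rewrite -eq /endpoint !count_rev.
move=> r1 r2 e.
have {}e : q = rev r2 ++ rev r1 by rewrite -rev_cat -e revK.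
have l0 : (level a b (endpoint origin (rev r2)) + level a b (endpoint origin r1) = 0)%R.
  have -> : endpoint origin r1 = endpoint origin (rev r1) by rewrite /endpoint !count_rev.
  by rewrite -level_endpoint_cat -e eq level_end.
suff : (level a b (endpoint origin (rev r2)) <= 0)%R by lia.
have szq : size q = a + b.
  by case: eq => <- <-; rewrite !add0n count_steps.
have szr : size (rev r2) <= a + b by rewrite -szq e size_cat leq_addr.
case: (posnP (size (rev r2))) => [/size0nil ->|pos]; first by rewrite endpoint0 level0.
move: szr; rewrite leq_eqVlt => /orP[/eqP full|lt].
  suff -> : rev r2 = q by rewrite eq level_end.
  have /size0nil r10 : size (rev r1) = 0 by move: szq; rewrite e size_cat full; lia.
  by rewrite e r10 cats0.
move/allP/(_ (size (rev r2))): sb; rewrite mem_iota e /lattice_point take_size_cat //=.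
have range : 1 <= size (rev r2) < 1 + (a + b - 1) by lia.
by move=> /(_ range); rewrite /level /endpoint /=; lia.
Qed.

(** Reversing a path exchanges departures and arrivals and reflects the levels. *)
Lemma departures_rev a b s c q :
  perm_eq [seq level a b d | d <- departures s origin (rev q)]
    [seq (level a b (endpoint c q) - level a b e)%R | e <- arrivals s c q].
Proof.
elim: q c => [|t q IH] c //=; rewrite rev_cons -cats1 departures_cat map_cat perm_catC /=.
rewrite /arrivals /= !map_cat endpoint_cons; apply: perm_cat; last exact: IH.
case: eqP => // -> /=; set x := level _ _ _; set y := (_ - _)%R.
suff -> : x = y by [].
rewrite /x /y /level /endpoint /= !count_rev.
by case: (s); lia.
Qed.

(** Along a closed path, starting elsewhere only shifts all levels by the same
    amount. *)
Lemma arrivals_rot_levels a b s p1 p2 :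
  level a b (endpoint origin (p1 ++ p2)) = 0%R ->
  perm_eq [seq level a b e | e <- arrivals s origin (p2 ++ p1)]
    [seq (level a b e - level a b (endpoint origin p1))%R | e <- arrivals s origin (p1 ++ p2)].
Proof.
rewrite level_endpoint_cat => l0; rewrite !arrivals_cat !map_cat perm_catC.
have sh c p (f : int -> int) : [seq f (level a b e) | e <- arrivals s c p] =
    [seq f (level a b e + level a b c)%R | e <- arrivals s origin p].
  rewrite -[c in LHS]translate0 arrivals_translate -map_comp.
  by apply: eq_map => e /=; rewrite level_translate.
have l2 : level a b (endpoint origin p2) = (- level a b (endpoint origin p1))%R by lia.
rewrite (sh (endpoint origin p2) p1 id).
rewrite (sh (endpoint origin p1) p2 (fun x => x - level a b (endpoint origin p1))%R).
rewrite (eq_map (g := fun e => (level a b e - level a b (endpoint origin p1))%R)); last first.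
  by move=> e /=; congr (_ + _)%R; exact: l2.
rewrite perm_cat2l; set u := [seq _ | _ <- _]; set v := [seq _ | _ <- _].
by suff -> : v = u by []; apply: eq_map => e /=; rewrite addrK.
Qed.

Definition conjugate_lengths a b (p : seq bool) : seq nat :=
  [seq count (fun e => (level a b n < level a b e)%R) (arrivals false origin p)
     | n <- arrivals true origin p].

(** Conjugation maps the steps that arrive at level l to the steps that depart
    from level M - l, where M is the maximal level; so the sweep for the
    conjugate path compares arrivals, in the opposite order. *)
Lemma conjugate_zeta_partition a b (p : (a + b).-tuple bool) :
  0 < a -> 0 < b -> coprime a b -> is_dyck a b p ->
  is_dyck a b (conjugate a b p) /\
  zeta_partition a b (conjugate a b p) =
  sort geq (conjugate_lengths a b p).
Proof.
move=> a0 b0 co D; rewrite /conjugate.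
set P := fun i => _; set k := find P _.
have hP : has P (iota 0 (a + b)).
  have [i ilt sb] := strictly_below_rot _ _ _ b0 co D.
  by apply/hasP; exists i; rewrite ?mem_iota.
have klt : k < a + b by move: hP; rewrite has_find size_iota.
have sb : strictly_below a b (rot k p).
  by have := nth_find 0 hP; rewrite -/k nth_iota.
set q := rot k p in sb *.
set p1 := take k p; set p2 := drop k p.
have pE : tval p = p1 ++ p2 by rewrite cat_take_drop.
have qE : q = p2 ++ p1 by [].
have [pend _] := D.
have qend : endpoint origin q = (b, a).
  by rewrite -pend qE pE /endpoint !count_cat ![_ p2 + _]addnC.
have Dq := is_dyck_rev _ _ _ qend sb.
split; first exact: Dq.
rewrite [tval _]/= zeta_partitionE //.
set m := level a b (endpoint origin p1).
have lev s : perm_eq [seq level a b d | d <- departures s origin (rev q)]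
    [seq (m - x)%R | x <- [seq level a b e | e <- arrivals s origin p]].
  apply: perm_trans (departures_rev a b s origin q) _.
  rewrite qend level_end.
  have -> : [seq (0 - level a b e)%R | e <- arrivals s origin q] =
      [seq (- x)%R | x <- [seq level a b e | e <- arrivals s origin q]].
    by elim: (arrivals _ _ _) => //= e r ->; congr cons; lia.
  have -> : [seq (m - x)%R | x <- [seq level a b e | e <- arrivals s origin p]] =
      [seq (- x)%R | x <- [seq (level a b e - m)%R | e <- arrivals s origin p]].
    by elim: (arrivals _ _ _) => //= e r ->; congr cons; lia.
  apply: perm_map; rewrite qE pE; apply: arrivals_rot_levels.
  by rewrite -pE pend level_end.
apply/perm_sortP.
- by move=> x y; exact: leq_total.
- by move=> x y z /= h1 h2; exact: leq_trans h2 h1.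
- by move=> x y /=; rewrite -eqn_leq => /eqP ->.
set E := departures false _ _.
rewrite -(eq_map (f := (fun x => count (fun y => (y < x)%R) (map (level a b) E)) \o level a b));
  last by move=> d /=; rewrite count_map.
rewrite map_comp; apply: perm_trans (perm_map _ (lev true)) _.
rewrite /conjugate_lengths -!map_comp; set u := [seq _ | _ <- _]; set v := [seq _ | _ <- _].
suff -> : u = v by [].
apply: eq_map => n /=; rewrite (permP (lev false)) !count_map.
by apply: eq_count => e /=; lia.
Qed.

(** * Distinctness and comparison of levels *)

Lemma mem_departures_bounds s p d : d \in departures s origin p ->
  [/\ d.1 <= count negb p, d.2 <= count id p & d.1 + d.2 < size p].
Proof.
case/mem_departures => p1 [p2 [-> ->]].
have := count_steps p1; rewrite !count_cat size_cat /= !add0n => e.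
by split; rewrite ?leq_addr //; lia.
Qed.

Lemma mem_arrivals_bounds s p d : d \in arrivals s origin p ->
  [/\ d.1 <= count negb p, d.2 <= count id p & 0 < d.1 + d.2].
Proof.
case/mem_arrivals => p1 [p2 [-> ->]].
have := count_steps (rcons p1 s); rewrite !count_cat size_rcons /= !add0n => e.
by split; rewrite ?leq_addr //; lia.
Qed.

Lemma departure_level_inj a b p s t c d : 0 < b -> coprime a b -> is_dyck a b p ->
  c \in departures s origin p -> d \in departures t origin p ->
  level a b c = level a b d -> c = d.
Proof.
move=> b0 co D /mem_departures_bounds[c1 c2 c3] /mem_departures_bounds[d1 d2 d3] e.
have sz := size_dyck _ _ _ D; case: D => -[nb na] _.
rewrite /= !add0n in nb na; rewrite nb na sz in c1 c2 c3 d1 d2 d3.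
case: (level_inj _ _ _ _ b0 co e) => // -[] [E F]; last by rewrite E /= in c3; lia.
by rewrite F /= in d3; lia.
Qed.

Lemma arrival_level_inj a b p s t c d : 0 < b -> coprime a b -> is_dyck a b p ->
  c \in arrivals s origin p -> d \in arrivals t origin p ->
  level a b c = level a b d -> c = d.
Proof.
move=> b0 co D /mem_arrivals_bounds[c1 c2 c3] /mem_arrivals_bounds[d1 d2 d3] e.
case: D => -[nb na] _.
rewrite /= !add0n in nb na; rewrite nb na in c1 c2 d1 d2.
by case: (level_inj _ _ _ _ b0 co e) => // -[] [E F];
  [rewrite E /= in c3 | rewrite F /= in d3].
Qed.

(** Two scales X and x related by q X = r x + s, with corrections s that vary by
    less than r, order their points in the same way.  This transports the order
    of the levels from the small grids to the large one. *)
Lemma lt_of_scaled (q r : nat) (x y X Y s t : int) :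
  (Posz q * X = Posz r * x + s)%R -> (Posz q * Y = Posz r * y + t)%R ->
  0 < q -> (`|s - t| < Posz r)%R -> (x = y -> X = Y) -> (X < Y)%R = (x < y)%R.
Proof.
move=> eX eY q0 st xy.
have [lt|gt|E] := ltgtP x y; last by rewrite (xy E) ltxx.
- by apply/negbNE/negP; rewrite -leNgt => le; nia.
- by apply/negbTE; rewrite -leNgt leNgt; apply/negP => lt; nia.
Qed.

Lemma departure_level0 a b p s c : 0 < b -> coprime a b -> is_dyck a b p ->
  c \in departures s origin p -> level a b c = 0%R -> c = origin.
Proof.
move=> b0 co D /mem_departures_bounds[c1 c2 c3] e.
have sz := size_dyck _ _ _ D; case: D => -[nb na] _.
rewrite /= !add0n in nb na; rewrite nb na sz in c1 c2 c3.
rewrite -(level0 a b) in e.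
case: (level_inj _ _ _ _ b0 co e) => // -[] [E F] //.
by rewrite E /= in c3; lia.
Qed.

Lemma arrival_level0 a b p s c : 0 < b -> coprime a b -> is_dyck a b p ->
  c \in arrivals s origin p -> level a b c = 0%R -> c = (b, a).
Proof.
move=> b0 co D /mem_arrivals_bounds[c1 c2 c3] e.
case: D => -[nb na] _.
rewrite /= !add0n in nb na; rewrite nb na in c1 c2.
rewrite -(level0 a b) in e.
by case: (level_inj _ _ _ _ b0 co e) => // [E|[] [E F]] //; rewrite E in c3.
Qed.

Lemma size_north_departures a b p : is_dyck a b p -> size (departures true origin p) = a.
Proof.
case=> -[_]; rewrite /= add0n => <- _; rewrite size_departures.
by apply: eq_count; case.
Qed.

Lemma size_east_departures a b p : is_dyck a b p -> size (departures false origin p) = b.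
Proof.
case=> -[]; rewrite /= add0n => <- _ _; rewrite size_departures.
by apply: eq_count; case.
Qed.

(** * Inserting a path at the top of another *)

Lemma mem_departures_mid s c p1 p2 : endpoint c p1 \in departures s c (p1 ++ s :: p2).
Proof. by rewrite departures_cat mem_cat /= eqxx mem_head orbT. Qed.

Lemma size_east_arrivals c p : size (arrivals false c p) = count negb p.
Proof. by rewrite size_map size_departures; apply: eq_count; case. Qed.

(** The last step of a Dyck path is its only east step that ends at (b, a). *)
Lemma east_arrivals_end a b p : 0 < b -> is_dyck a b p ->
  count (fun e => e != (b, a)) (arrivals false origin p) = b - 1.
Proof.
move=> b0 D; have [[nb na] _] := D; rewrite /= !add0n in nb na.
transitivity (count (predC1 b) [seq e.1 | e <- arrivals false origin p]).
  rewrite [RHS]count_map; apply: eq_in_count => e eP /=; congr (~~ _).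
  have [e1 e2 _] := mem_arrivals_bounds _ _ _ eP.
  have e0 := dyck_arrival_ge0 _ _ _ _ _ D eP.
  rewrite nb na in e1 e2; case: e e0 e1 e2 {eP} => x y; rewrite /level /= => e0 e1 e2.
  rewrite xpair_eqE; case: eqP => //= xb; subst x.
  by apply/eqP; nia.
rewrite unzip1_east_arrivals nb.
have := count_predC (pred1 b) (iota 1 b); rewrite size_iota.
rewrite count_uniq_mem ?iota_uniq // mem_iota b0 add1n ltnS leqnn => e.
by rewrite -[X in X - 1]e addKn.
Qed.

Lemma dyck_positive_level a b p : 0 < a -> 0 < b -> is_dyck a b p ->
  exists p1 p2, p = p1 ++ p2 /\ (0 < level a b (endpoint origin p1))%R.
Proof.
move=> a0 b0 D; have : 0 < size (departures true origin p).
  by rewrite (size_north_departures _ _ _ D).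
case E : (departures true origin p) => [//|d r] _.
have dp : d \in departures true origin p by rewrite E mem_head.
have d0 := dyck_departure_ge0 _ _ _ _ _ D dp.
have [p1 [p2 [e de]]] := mem_departures _ _ _ _ dp.
exists (rcons p1 true), p2; rewrite cat_rcons; split=> //.
by rewrite endpoint_rcons -de level_step; lia.
Qed.

Section Insertion.

Context (a1 b1 a2 b2 : nat) (A B P2 : seq bool).
Let A1 := rcons A true.
Let P1 := A1 ++ B.
Let P := A1 ++ P2 ++ B.
Let a := a1 + a2.
Let b := b1 + b2.
Let u := endpoint origin A1.
Context (a1_gt0 : 0 < a1) (b1_gt0 : 0 < b1) (a2_gt0 : 0 < a2) (b2_gt0 : 0 < b2).
Context (det : a1 * b2 = b1 * a2 + 1).
Context (co1 : coprime a1 b1) (co2 : coprime a2 b2).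
Context (D1 : is_dyck a1 b1 P1) (D2 : is_dyck a2 b2 P2).
Context (top : forall q1 q2, P1 = q1 ++ q2 ->
  (level a1 b1 (endpoint origin q1) <= level a1 b1 u)%R).

Context (co : coprime a b).

Let m := level a b u.
(* [m] is the level in the large grid of the point where [P2] is inserted. A point
   of [P1] with at least [k] steps before it comes after the insertion and loses one
   level, the level of (b2, a2) being -1.  Departures are after the insertion
   from index [size A1] on, arrivals from the next index on. *)
Let low (k : nat) (c : nat * nat) : int := (level a b c - (k <= c.1 + c.2)%:Z)%R.
Let high (c : nat * nat) : int := (level a b c + m)%R.
Let sheet (k : nat) (c : nat * nat) := c.1 <= b1 /\
  (c.1 + c.2 < k /\ c.1 <= u.1 \/ k <= c.1 + c.2 /\ u.1 <= c.1).
Let k := size A1.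

(** The levels of the small and of the large grid on the same point: since
    a1 * b2 - b1 * a2 = 1, they are proportional up to the abscissa. *)
Lemma level_first c : (Posz b1 * level a b c = Posz b * level a1 b1 c + Posz c.1)%R.
Proof.
have := congr1 (muln c.1) det; rewrite /level /a /b; case: c => x y /=; lia.
Qed.

Lemma level_second c : (Posz b2 * level a b c = Posz b * level a2 b2 c - Posz c.1)%R.
Proof.
have := congr1 (muln c.1) det; rewrite /level /a /b; case: c => x y /=; lia.
Qed.

Lemma size_u : u.1 + u.2 = k.
Proof. by have := count_steps A1; rewrite /u /= !add0n addnC. Qed.

Lemma u1_le : u.1 <= b1.
Proof.
case: D1 => -[<- _] _; rewrite /u /P1 /= !add0n count_cat; exact: leq_addr.
Qed.

Lemma size_endpoint c p : (endpoint c p).1 + (endpoint c p).2 = c.1 + c.2 + size p.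
Proof. by have := count_steps p; rewrite /=; lia. Qed.

Lemma departure_before_top s c : c \in departures s origin A1 ->
  c.1 + c.2 < k /\ c.1 <= u.1.
Proof.
case/mem_departures => p1 [p2 [e ->]]; rewrite size_endpoint /u /k e size_cat /=.
by rewrite count_cat; split; lia.
Qed.

Lemma departure_after_top s c : c \in departures s u B -> k <= c.1 + c.2 /\ u.1 <= c.1.
Proof.
case/mem_departures => p1 [p2 [e ->]]; rewrite size_endpoint size_u /=.
by split; lia.
Qed.

Lemma arrival_before_top s c : c \in arrivals s origin A1 -> c.1 + c.2 <= k /\ c.1 <= u.1.
Proof.
case/mem_arrivals => p1 [p2 [e ->]]; rewrite size_endpoint /u /k e size_cat /=.
by rewrite count_cat; split; lia.
Qed.

Lemma arrival_after_top s c : c \in arrivals s u B -> k < c.1 + c.2 /\ u.1 <= c.1.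
Proof.
case/mem_arrivals => p1 [p2 [e ->]]; rewrite size_endpoint size_u size_rcons /=.
by split; lia.
Qed.

Lemma sheet_departure s c : c \in departures s origin P1 -> sheet k c.
Proof.
move=> cP; have [c1 _ _] := mem_departures_bounds _ _ _ cP.
have [e _] := D1; split; first by case: e c1; rewrite /= !add0n => ->.
move: cP; rewrite departures_cat mem_cat => /orP[/departure_before_top|/departure_after_top]; [by left | by right].
Qed.

Lemma sheet_arrival s c : c \in arrivals s origin P1 -> sheet k.+1 c.
Proof.
move=> cP; have [c1 _ _] := mem_arrivals_bounds _ _ _ cP.
have [e _] := D1; split; first by case: e c1; rewrite /= !add0n => ->.
move: cP; rewrite arrivals_cat mem_cat => /orP[/arrival_before_top|/arrival_after_top]; [by left | by right].
Qed.

(** The levels of the inserted path: those of [P2] raised by [m], and those of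
    [P1], lowered by one after the insertion. *)
Lemma levels_departures s :
  perm_eq [seq level a b c | c <- departures s origin P]
    ([seq low k c | c <- departures s origin P1] ++ [seq high c | c <- departures s origin P2]).
Proof.
rewrite /P /P1 !departures_cat !map_cat -/u -catA.
have -> : [seq low k c | c <- departures s origin A1] = [seq level a b c | c <- departures s origin A1].
  by apply/eq_in_map => c /departure_before_top[lt _]; rewrite /low leqNgt lt subr0.
rewrite perm_cat2l perm_catC.
have -> : [seq level a b c | c <- departures s u P2] = [seq high c | c <- departures s origin P2].
  rewrite -{1}[u]translate0 departures_translate -map_comp.
  by apply: eq_map => c /=; rewrite level_translate.
rewrite perm_cat2r.
have -> : endpoint u P2 = translate (b2, a2) u.
  by case: D2 => e _; rewrite endpoint_translate e; congr (_, _); exact: addnC.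
rewrite departures_translate -map_comp; set x := map _ _; set y := map _ _.
suff -> : x = y by [].
apply/eq_in_map => c /departure_after_top[ge _] /=; rewrite level_translate /low ge.
by rewrite /level /a /b /=; lia.
Qed.

Lemma levels_arrivals s :
  perm_eq [seq level a b c | c <- arrivals s origin P]
    ([seq low k.+1 c | c <- arrivals s origin P1] ++ [seq high c | c <- arrivals s origin P2]).
Proof.
rewrite /P /P1 !arrivals_cat !map_cat -/u -catA.
have -> : [seq low k.+1 c | c <- arrivals s origin A1] = [seq level a b c | c <- arrivals s origin A1].
  by apply/eq_in_map => c /arrival_before_top[lt _]; rewrite /low leqNgt ltnS lt subr0.
rewrite perm_cat2l perm_catC.
have -> : [seq level a b c | c <- arrivals s u P2] = [seq high c | c <- arrivals s origin P2].
  rewrite -{1}[u]translate0 arrivals_translate -map_comp.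
  by apply: eq_map => c /=; rewrite level_translate.
rewrite perm_cat2r.
have -> : endpoint u P2 = translate (b2, a2) u.
  by case: D2 => e _; rewrite endpoint_translate e; congr (_, _); exact: addnC.
rewrite arrivals_translate -map_comp; set x := map _ _; set y := map _ _.
suff -> : x = y by [].
apply/eq_in_map => c /arrival_after_top[ge _] /=; rewrite level_translate /low ge.
by rewrite /level /a /b /=; lia.
Qed.

(** The correction c.1 (before the cut) or c.1 - b1 (after it) stays in an
    interval of length b1, because the path moves only to the right. *)
Lemma low_level_scaled j c : sheet j c ->
  exists2 o, (Posz b1 * low j c = Posz b * level a1 b1 c + o)%R
    & (Posz u.1 - Posz b1 <= o <= Posz u.1)%R /\ (j <= c.1 + c.2 -> (o <= 0)%R).
Proof.
have e := level_first c; have ub := u1_le.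
case=> cb [[lt le]|[ge le]]; rewrite /low.
  by exists (Posz c.1); rewrite leqNgt lt ?subr0 //; split; lia.
by exists (Posz c.1 - Posz b1)%R; rewrite ?ge; [rewrite mulrBr e | split]; lia.
Qed.

Lemma low_lt j c d : sheet j c -> sheet j d ->
  (level a1 b1 c = level a1 b1 d -> c = d) ->
  (low j c < low j d)%R = (level a1 b1 c < level a1 b1 d)%R.
Proof.
move=> /low_level_scaled[o e [o1 _]] /low_level_scaled[o' e' [o1' _]] inj.
apply: (lt_of_scaled _ _ _ _ _ _ _ _ e e' b1_gt0); first by rewrite /b; lia.
by move/inj ->.
Qed.

Lemma high_lt c d : c.1 <= b2 -> d.1 <= b2 ->
  (level a2 b2 c = level a2 b2 d -> c = d) ->
  (high c < high d)%R = (level a2 b2 c < level a2 b2 d)%R.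
Proof.
move=> cb db inj; rewrite /high ltrD2r.
apply: (lt_of_scaled _ _ _ _ _ _ _ _ (level_second c) (level_second d) b2_gt0).
  by rewrite /b; lia.
by move/inj ->.
Qed.

Lemma top_gt0 : (0 < level a1 b1 u)%R.
Proof.
have [q1 [q2 [e l0]]] := dyck_positive_level _ _ _ a1_gt0 b1_gt0 D1.
exact: lt_le_trans l0 (top _ _ e).
Qed.

Lemma top_arrival : u \in arrivals true origin P1.
Proof.
rewrite arrivals_cat mem_cat /A1 -cats1 arrivals_cat mem_cat.
by rewrite /u /A1 endpoint_rcons mem_head orbT.
Qed.

(** A departure at the level of the top in the small grid is the top itself; it
    comes after the cut and is therefore lowered to m - 1. *)
Lemma departure_lt_top s c : c \in departures s origin P1 -> (low k c < m)%R.
Proof.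
move=> cP; have cs := sheet_departure _ _ cP; have [o e [o1 o2]] := low_level_scaled _ _ cs.
have eu := level_first u.
have le : (level a1 b1 c <= level a1 b1 u)%R.
  have [q1 [q2 [E ->]]] := mem_departures _ _ _ _ cP.
  exact: top E.
have [lt|//] := ltrP (level a1 b1 c) (level a1 b1 u).
  rewrite (lt_of_scaled _ _ _ _ _ _ _ _ e eu b1_gt0) //; first by rewrite /b; lia.
  by move=> E; rewrite E ltxx in lt.
move=> ge; have cu : c = u.
  have el : level a1 b1 c = level a1 b1 u by apply/eqP; rewrite eq_le le ge.
  have cn : c <> origin by move=> c0; move: el top_gt0; rewrite c0 level0 => <-.
  have [c1 c2 c3] := mem_departures_bounds _ _ _ cP.
  have [u1 u2 _] := mem_arrivals_bounds _ _ _ top_arrival.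
  have sz := size_dyck _ _ _ D1.
  have [[e1 e2] _] := D1; rewrite /= !add0n in e1 e2.
  rewrite e1 in c1 u1; rewrite e2 in c2 u2; rewrite sz in c3.
  case: (level_inj _ _ _ _ b1_gt0 co1 el) => // -[] [E F] //.
  by rewrite E /= in c3; lia.
by rewrite /low cu size_u leqnn /m; lia.
Qed.

Lemma second_level_gt0 c : c.1 <= b2 -> (0 < level a2 b2 c)%R -> (0 < level a b c)%R.
Proof.
move=> cb l0; have e0 : (Posz b2 * 0 = Posz b * 0 + 0)%R by rewrite !mulr0.
have e : (Posz b2 * level a b c = Posz b * level a2 b2 c + - Posz c.1)%R.
  exact: level_second.
rewrite (lt_of_scaled _ _ _ _ _ _ _ _ e0 e b2_gt0) //; first by rewrite /b; lia.
by move=> E; rewrite -E ltxx in l0.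
Qed.

Lemma high_departure_ge s c : c \in departures s origin P2 -> (m <= high c)%R.
Proof.
move=> cP; rewrite /high lerDr.
have c0 := dyck_departure_ge0 _ _ _ _ _ D2 cP.
have [c1 _ _] := mem_departures_bounds _ _ _ cP.
have [[e1 e2] _] := D2; rewrite /= !add0n in e1 e2; rewrite e1 in c1.
case: (eqVneq (level a2 b2 c) 0%R) => [z|nz].
  by rewrite (departure_level0 _ _ _ _ _ b2_gt0 co2 D2 cP z) level0.
by apply/ltW/second_level_gt0 => //; rewrite lt_neqAle eq_sym nz.
Qed.

Lemma arrival_lt_top s c : c \in arrivals s origin P1 -> c != u ->
  (level a1 b1 c < level a1 b1 u)%R.
Proof.
move=> cP cu; rewrite lt_neqAle; apply/andP; split.
  apply/eqP => /(arrival_level_inj _ _ _ _ _ _ _ b1_gt0 co1 D1 cP top_arrival) e.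
  by rewrite e eqxx in cu.
have [q1 [q2 [E ->]]] := mem_arrivals _ _ _ _ cP.
exact: top E.
Qed.

Lemma low_arrival_lt s c : c \in arrivals s origin P1 -> c != u -> (low k.+1 c < m - 1)%R.
Proof.
move=> cP cu; have lt := arrival_lt_top _ _ cP cu.
have [o e [o1 _]] := low_level_scaled _ _ (sheet_arrival _ _ cP).
have eu : (Posz b1 * (m - 1) = Posz b * level a1 b1 u + (Posz u.1 - Posz b1))%R.
  by rewrite mulrBr mulr1 /m level_first addrA.
rewrite (lt_of_scaled _ _ _ _ _ _ _ _ e eu b1_gt0) //; first by rewrite /b; lia.
by move=> E; rewrite E ltxx in lt.
Qed.

(** The top as an arrival point precedes the cut, hence is not lowered, whereas the
    end of [P2], which coincides with it after the cut, is at level m - 1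
    ([high_end]). *)
Lemma low_top : low k.+1 u = m.
Proof. by rewrite /low size_u ltnn subr0. Qed.

Lemma high_arrival_gt s c : c \in arrivals s origin P2 -> c != (b2, a2) -> (m < high c)%R.
Proof.
move=> cP ce; rewrite /high ltrDr.
have c0 := dyck_arrival_ge0 _ _ _ _ _ D2 cP.
have [c1 _ _] := mem_arrivals_bounds _ _ _ cP.
have [[e1 e2] _] := D2; rewrite /= !add0n in e1 e2; rewrite e1 in c1.
apply: second_level_gt0 => //; rewrite lt_neqAle c0 andbT eq_sym; apply/eqP => z.
move: ce; rewrite (arrival_level0 _ _ _ _ _ b2_gt0 co2 D2 cP z).
by rewrite eqxx.
Qed.

Lemma high_end : high (b2, a2) = (m - 1)%R.
Proof. by rewrite /high /level /a /b /=; lia. Qed.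

Lemma low_departure_ge0 s c : c \in departures s origin P1 -> (0 <= low k c)%R.
Proof.
move=> cP; have c0 := dyck_departure_ge0 _ _ _ _ _ D1 cP.
have [o e [o1 o2]] := low_level_scaled _ _ (sheet_departure _ _ cP).
case: (eqVneq (level a1 b1 c) 0%R) => [z|nz].
  have := departure_level0 _ _ _ _ _ b1_gt0 co1 D1 cP z => ->.
  by rewrite /low level0 /k size_rcons.
have l0 : (0 < level a1 b1 c)%R by rewrite lt_neqAle eq_sym nz.
have e0 : (Posz b1 * 0 = Posz b * 0 + 0)%R by rewrite !mulr0.
apply: ltW; rewrite (lt_of_scaled _ _ _ _ _ _ _ _ e0 e b1_gt0) //.
  by rewrite /b; have := u1_le; lia.
by move=> E; rewrite -E ltxx in l0.
Qed.

Lemma top_level_ge0 : (0 <= m)%R.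
Proof.
have e := level_first u; have := top_gt0; rewrite -/m in e; rewrite /b in e => t.
have e0 : (0 <= Posz (b1 + b2) * level a1 b1 u)%R by rewrite mulr_ge0 // ltW.
have : (0 <= Posz b1 * m)%R by lia.
by rewrite pmulr_rge0.
Qed.

Lemma insertion_dyck : is_dyck a b P.
Proof.
have eP : endpoint origin P = (b, a).
  have [e1 _] := D1; have [e2 _] := D2.
  move: e1 e2; rewrite /P /P1 /endpoint !count_cat /a /b => -[<- <-] [<- <-].
  by rewrite !add0n -!addnA; congr (_ + _, _ + _); exact: addnC.
split=> // q1 q2 e; case: q2 e => [|s q2] e.
  by rewrite cats0 in e; rewrite -e eP level_end.
have /(map_f (level a b)) : endpoint origin q1 \in departures s origin P.
  by rewrite e mem_departures_mid.
rewrite (perm_mem (levels_departures s)) mem_cat => /orP[] /mapP[c cP ->].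
  exact: low_departure_ge0 cP.
exact: le_trans top_level_ge0 (high_departure_ge _ _ cP).
Qed.

(** All the departures from [P1] are below those from [P2], and the order inside
    [P1] and inside [P2] is unchanged.  So a step of [P2] sees in addition all
    the [b1] east steps of [P1], and a step of [P1] sees nothing new. *)
Lemma insertion_zeta : zeta_partition a b P =
  [seq b1 + x | x <- zeta_partition a2 b2 P2] ++ zeta_partition a1 b1 P1.
Proof.
have b0 : 0 < b by rewrite /b addn_gt0 b1_gt0.
have a0 : 0 < a by rewrite /a addn_gt0 a1_gt0.
rewrite !zeta_partitionE //; last exact: insertion_dyck.
set E1 := departures false origin P1; set E2 := departures false origin P2.
symmetry; apply: sort_geq_eq.
  apply: sorted_geq_cat.
  - rewrite sorted_map; apply: sub_sorted (sorted_sort_geq _) => x y /=.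
    by rewrite leq_add2l.
  - exact: sorted_sort_geq.
  move=> _ y /mapP[x _ ->]; rewrite mem_sort => /mapP[d _ ->].
  apply: leq_trans (count_size _ _) _.
  by rewrite (size_east_departures _ _ _ D1) leq_addr.
pose F x := count (fun y : int => (y < x)%R) [seq level a b e | e <- departures false origin P].
rewrite [X in perm_eq _ X](_ : _ = [seq F x | x <- [seq level a b d | d <- departures true origin P]]);
  last first.
  by rewrite -map_comp; apply: eq_map => d; rewrite /F /= count_map.
rewrite perm_sym; apply: perm_trans (perm_map F (levels_departures true)) _.
rewrite map_cat perm_catC -!map_comp; apply: perm_cat.
  apply: (@perm_trans _ [seq b1 + x | x <- [seq count (fun e => (level a2 b2 e < level a2 b2 d)%R) E2
      | d <- departures true origin P2]]); last by rewrite perm_map // perm_sym perm_sort.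
  rewrite -map_comp; apply: perm_eq_map_in => d dP /=.
  rewrite /F (permP (levels_departures false)) count_cat !count_map; congr (_ + _).
    rewrite -[RHS](size_east_departures _ _ _ D1) -(count_predT (departures _ _ _)).
    apply: eq_in_count => e eP /=.
    by rewrite (lt_le_trans (departure_lt_top _ _ eP)) // (high_departure_ge _ _ dP).
  apply: eq_in_count => e eP /=; have [[nb _] _] := D2; rewrite /= add0n in nb.
  apply: high_lt.
  - by have [+ _ _] := mem_departures_bounds _ _ _ eP; rewrite nb.
  - by have [+ _ _] := mem_departures_bounds _ _ _ dP; rewrite nb.
  exact: (departure_level_inj _ _ _ _ _ _ _ b2_gt0 co2 D2 eP dP).
rewrite perm_sym perm_sort perm_sym; apply: perm_eq_map_in => d dP /=.
rewrite /F (permP (levels_departures false)) count_cat !count_map.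
rewrite [X in _ + X](eq_in_count (a2 := pred0)) ?count_pred0 ?addn0; last first.
  move=> e eP /=; apply/negbTE; rewrite -leNgt; apply: le_trans (high_departure_ge _ _ eP).
  exact: ltW (departure_lt_top _ _ dP).
apply: eq_in_count => e eP /=; apply: low_lt.
- exact: sheet_departure eP.
- exact: sheet_departure dP.
exact: (departure_level_inj _ _ _ _ _ _ _ b1_gt0 co1 D1 eP dP).
Qed.

(** The arrivals are separated like the departures, with one exchange: the north
    step into the top lands at level m, the lowest of [P2], and the last east
    step of [P2] lands at level m - 1, the highest of [P1].  The part of the top,
    which was 0, becomes [b2 - 1], the number of the other east steps of [P2]. *)
Lemma insertion_conjugate_lengths : exists s,
  [/\ perm_eq (conjugate_lengths a1 b1 P1) (0 :: s),
      {in conjugate_lengths a2 b2 P2, forall x, x <= b2 - 1}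
    & perm_eq (conjugate_lengths a b P)
       ([seq b2 + x | x <- s] ++ (b2 - 1) :: conjugate_lengths a2 b2 P2)].
Proof.
set E1 := arrivals false origin P1; set E2 := arrivals false origin P2.
pose N := arrivals true origin A ++ arrivals true u B.
have N1 : perm_eq (arrivals true origin P1) (u :: N).
  rewrite /P1 /A1 -cats1 -catA !arrivals_cat /N -endpoint_cat cats1 perm_catCA.
  by rewrite /= /u /A1 endpoint_rcons.
have NP n : n \in N -> n \in arrivals true origin P1 /\ n != u.
  move=> nN; split; first by rewrite (perm_mem N1) inE nN orbT.
  apply/eqP => nu; move: nN; rewrite mem_cat nu => /orP[|/arrival_after_top[]].
    move/mem_arrivals => [p1 [p2 [e /(congr1 (fun c => c.1 + c.2))]]].
    rewrite size_endpoint size_u /k /A1 e !size_rcons size_cat size_rcons /=; lia.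
  by rewrite size_u ltnn.
have EP e : e \in E1 -> e != u.
  move=> eE; apply/eqP => eu.
  have [q1 [q2 [E ee]]] := mem_arrivals _ _ _ _ eE.
  have := top q1 (false :: q2); rewrite -cat_rcons => /(_ E).
  by move: ee; rewrite endpoint_rcons eu => ->; rewrite (level_step _ _ false); lia.
have nb2 : (endpoint origin P2).1 = b2 by case: D2 => -> _.
pose G n := count (fun e => (level a1 b1 n < level a1 b1 e)%R) E1.
exists [seq G n | n <- N]; split.
- apply: perm_trans (perm_map _ N1) _; rewrite /= -/E1.
  rewrite (eq_in_count (a2 := pred0)) ?count_pred0 // => e eE /=.
  apply/negbTE; rewrite -leNgt; apply: ltW.
  exact: arrival_lt_top eE (EP _ eE).
- move=> _ /mapP[n nP ->]; rewrite -(east_arrivals_end _ _ _ b2_gt0 D2).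
  rewrite (eq_in_count (a1 := fun e => (level a2 b2 n < level a2 b2 e)%R)
    (a2 := fun e => (level a2 b2 n < level a2 b2 e)%R && (e != (b2, a2)))).
    by apply: sub_count => e /= /andP[].
  move=> e eE /=; case: eqP => [->|_]; last by rewrite andbT.
  rewrite level_end andbF; apply/negbTE; rewrite -leNgt; exact: dyck_arrival_ge0 D2 nP.
pose F (x : int) := count (fun y : int => (x < y)%R) [seq level a b e | e <- arrivals false origin P].
have FE x : F x = count (fun e => (x < low k.+1 e)%R) E1 + count (fun e => (x < high e)%R) E2.
  by rewrite /F (permP (levels_arrivals false)) count_cat !count_map.
have -> : conjugate_lengths a b P = [seq F x | x <- [seq level a b n | n <- arrivals true origin P]].
  by rewrite -map_comp; apply: eq_map => n; rewrite /F /= count_map.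
apply: perm_trans (perm_map F (levels_arrivals true)) _.
rewrite map_cat -cat1s catA; apply: perm_cat; last first.
  rewrite -map_comp; apply: perm_eq_map_in => n nP /=; rewrite FE.
  rewrite [X in X + _](eq_in_count (a2 := pred0)) ?count_pred0 ?add0n; last first.
    move=> e eE /=; apply/negbTE; rewrite -leNgt.
    apply: le_trans (ltW (low_arrival_lt _ _ eE (EP _ eE))) _.
    case: (eqVneq n (b2, a2)) => [->|ne]; first by rewrite high_end.
    by have := high_arrival_gt _ _ nP ne; lia.
  apply: eq_in_count => e eE; apply: high_lt.
  - have [+ _ _] := mem_arrivals_bounds _ _ _ nP.
    by rewrite -[count _ _]add0n -[0 + _]/((endpoint origin P2).1) nb2.
  - have [+ _ _] := mem_arrivals_bounds _ _ _ eE.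
    by rewrite -[count _ _]add0n -[0 + _]/((endpoint origin P2).1) nb2.
  exact: (arrival_level_inj _ _ _ _ _ _ _ b2_gt0 co2 D2 nP eE).
apply: perm_trans (perm_map F (perm_map (low k.+1) N1)) _.
rewrite [X in perm_eq X _]/= -cat1s perm_catC; apply: perm_cat.
  rewrite -!map_comp; apply: perm_eq_map_in => n /NP[nP nu] /=; rewrite FE addnC; congr (_ + _).
    rewrite -[RHS]nb2 /= add0n -(size_east_arrivals origin) -count_predT.
    apply: eq_in_count => e eE /=; have lt := low_arrival_lt _ _ nP nu.
    case: (eqVneq e (b2, a2)) => [->|ne]; first by rewrite high_end.
    by have := high_arrival_gt _ _ eE ne; lia.
  apply: eq_in_count => e eE; apply: low_lt.
  - exact: sheet_arrival nP.
  - exact: sheet_arrival eE.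
  exact: (arrival_level_inj _ _ _ _ _ _ _ b1_gt0 co1 D1 nP eE).
rewrite low_top FE [X in X + _](eq_in_count (a2 := pred0)) ?count_pred0 ?add0n; last first.
  move=> e eE /=; apply/negbTE; rewrite -leNgt.
  by have := low_arrival_lt _ _ eE (EP _ eE); lia.
rewrite -(east_arrivals_end _ _ _ b2_gt0 D2) -/E2.
rewrite (eq_in_count (a2 := fun e => e != (b2, a2))) // => e eE /=.
case: (eqVneq e (b2, a2)) => [->|ne]; first by rewrite high_end; lia.
exact: high_arrival_gt eE ne.
Qed.

End Insertion.

(** * Paths and their bounded partitions *)

Lemma north_steps_from_ge x p : all (leq x) (north_steps_from x p).
Proof.
elim: p x => [|[] p IH] x //=; first by rewrite leqnn IH.
by apply: sub_all (IH x.+1) => y; exact: ltnW.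
Qed.

(** A path of known length is determined by its bounded partition. *)
Lemma north_steps_from_inj x p q : size p = size q ->
  north_steps_from x p = north_steps_from x q -> p = q.
Proof.
elim: p q x => [|s p IH] [|t q] x //= [sz].
case: s; case: t => /= e.
- by case: e => /(IH _ _ sz) ->.
- by have := north_steps_from_ge x.+1 q; rewrite -e /= ltnn.
- by have := north_steps_from_ge x.+1 p; rewrite e /= ltnn.
by rewrite (IH _ _ sz e).
Qed.

Lemma north_steps_from_shift x y p :
  north_steps_from (y + x) p = [seq y + z | z <- north_steps_from x p].
Proof. by elim: p x => [|[] p IH] x //=; rewrite -?addnS IH. Qed.

Lemma bounded_partition_cat p q : bounded_partition (p ++ q) =
  [seq count negb p + x | x <- bounded_partition q] ++ bounded_partition p.
Proof.
rewrite /bounded_partition map_rev -rev_cat; congr rev.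
have gen x : north_steps_from x (p ++ q) =
    north_steps_from x p ++ north_steps_from (x + count negb p) q.
  by elim: p x => [|[] p IH] x /=; rewrite ?addn0 // IH // addnS.
by rewrite /north_steps gen add0n -[in LHS](addn0 (count negb p)) north_steps_from_shift.
Qed.

(** That zeta maps Dyck paths to Dyck paths excludes the default value in its
    definition. *)
Lemma bounded_partition_zeta a b (p : (a + b).-tuple bool) : 0 < a ->
  zeta_bijective a b -> p \in dyck_paths a b ->
  bounded_partition (zeta a b p) = zeta_partition a b p.
Proof.
move=> a0 [_ im] pD.
have : zeta a b p \in dyck_paths a b by rewrite -im imset_f.
rewrite /zeta; case: pickP => [q /andP[_ /eqP //]|_] /=.
rewrite inE /= => /andP[/eqP]; rewrite count_nseq mul0n => az; lia.
Qed.

Lemma zeta_eq a b (p q : (a + b).-tuple bool) : 0 < a ->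
  zeta_bijective a b -> p \in dyck_paths a b ->
  bounded_partition q = zeta_partition a b p -> zeta a b p = q.
Proof.
move=> a0 bij pD; rewrite -bounded_partition_zeta // => /(can_inj revK) e.
by apply/val_inj/(north_steps_from_inj 0); rewrite ?size_tuple // e.
Qed.

Lemma zeta_invK a b (q : (a + b).-tuple bool) :
  zeta_bijective a b -> q \in dyck_paths a b ->
  zeta_inv a b q \in dyck_paths a b /\ zeta a b (zeta_inv a b q) = q.
Proof.
move=> [_ im] qD; rewrite /zeta_inv; case: pickP => [p /andP[pD /eqP //]|no] /=.
by move: qD; rewrite -im => /imsetP[p pD e]; have := no p; rewrite pD e eqxx.
Qed.

Lemma bounded_partition_chi a b (p : (a + b).-tuple bool) : 0 < a -> 0 < b ->
  coprime a b -> zeta_bijective a b -> p \in dyck_paths a b ->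
  bounded_partition (chi a b (zeta a b p)) = sort geq (conjugate_lengths a b p).
Proof.
move=> a0 b0 co bij pD; rewrite /chi.
have zD : zeta a b p \in dyck_paths a b by case: (bij) => _ <-; rewrite imset_f.
have [iD iE] := zeta_invK _ _ _ bij zD.
have -> : zeta_inv a b (zeta a b p) = p by case: (bij) => inj _; exact: inj.
have [cD cE] := conjugate_zeta_partition _ _ p a0 b0 co (elimT (dyckP _ _ _) pD).
by rewrite bounded_partition_zeta // ?cE //; apply/dyckP.
Qed.

(** * The conjugate-area map on a concatenation *)

(** What it means for the rows of two partitions to be glued in this way.  The
    box with southwest corner (b1, a1 - 1) is the only box of the rectangle
    [b1, b1 + b2] x [0, a1] that the line from (0, 0) to (b1 + b2, a1 + a2)
    crosses, because the level of (b1, a1) is a1 * b2 - b1 * a2 = 1. *)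
Lemma glued_diagram (a1 b1 a2 b2 : nat) (S L : seq nat) :
  0 < b2 -> a1 * b2 = b1 * a2 + 1 -> (size S).+1 = a1 ->
  (forall j, nth 0 L j <= b2 - 1) ->
  let lam := [seq b2 + x | x <- S] ++ b2 - 1 :: L in
  [/\ (forall x y, x < b1 -> y < a1 ->
         rotated_diagram (a1 + a2) (b1 + b2) lam (x, y)
         = rotated_diagram a1 b1 (rcons S 0) (x, y)),
      (forall x y, b1 <= x < b1 + b2 -> a1 <= y < a1 + a2 ->
         rotated_diagram (a1 + a2) (b1 + b2) lam (x, y)
         = rotated_diagram a2 b2 L (x - b1, y - a1))
    & (forall x y, x < b1 + b2 -> y < a1 + a2 ->
         ~~ ((x < b1) && (y < a1)) -> ~~ ((b1 <= x) && (a1 <= y)) ->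
         rotated_diagram (a1 + a2) (b1 + b2) lam (x, y)
         = below_diagonal (a1 + a2) (b1 + b2) (x, y))].
Proof.
move=> b2_gt0 det szs L_le lam; rewrite /lam.
(* size S = a1 - 1 is the row just below the point (b1, a1). *)
have row y : nth 0 ([seq b2 + x | x <- S] ++ b2 - 1 :: L) y =
    if y < size S then b2 + nth 0 S y else if y == size S then b2 - 1 else nth 0 L (y - a1).
  rewrite nth_cat size_map; case: ltnP => [lt|ge].
    by rewrite (nth_map 0).
  case: eqP => [->|ne]; first by rewrite subnn.
  by have -> : y - size S = (y - a1).+1 by lia.
have row1 y : y < a1 -> nth 0 (rcons S 0) y = if y < size S then nth 0 S y else 0.
  by move=> ya; rewrite nth_rcons; case: ltnP => // _; case: eqP.
split=> [x y xb ya|x y /andP[bx xb] /andP[ay ya]|x y xb ya out1 out2];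
  rewrite /rotated_diagram /below_diagonal /= row.
- rewrite row1 //; case: (ltnP y (size S)) => [lt|ge]; first by lia.
  have -> : y == size S by lia.
  by lia.
- have -> : (y < size S) = false by lia.
  have -> : (y == size S) = false by lia.
  by lia.
case: (ltnP y (size S)) => [lt|ge].
  have bx : b1 <= x by lia.
  have -> : (b1 + b2) * y.+1 <= (a1 + a2) * x.
    have le1 : (b1 + b2) * y.+1 <= (b1 + b2) * (a1 - 1) by rewrite leq_mul2l; lia.
    have le2 : (a1 + a2) * b1 <= (a1 + a2) * x by rewrite leq_mul2l bx orbT.
    have le3 : (b1 + b2) * (a1 - 1) + (b1 + b2) = (b1 + b2) * a1.
      by rewrite -mulnSr; congr muln; lia.
    by lia.
  by lia.
case: eqP => [ys|ny].
  have ya1 : y.+1 = a1 by lia.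
  have bx : b1 <= x by lia.
  rewrite ya1; case: (leqP x b1) => [xb1|lt].
    have -> : x = b1 by lia.
    by lia.
  have le2 : (a1 + a2) * b1.+1 <= (a1 + a2) * x by rewrite leq_mul2l lt orbT.
  by rewrite mulnS in le2; lia.
have ay : a1 <= y by lia.
have xb1 : x < b1 by lia.
have -> : (b1 + b2) * y.+1 <= (a1 + a2) * x = false.
  have le1 : (b1 + b2) * a1 <= (b1 + b2) * y.+1 by rewrite leq_mul2l (leqW ay) orbT.
  have le2 : (a1 + a2) * x <= (a1 + a2) * b1 by rewrite leq_mul2l (ltnW xb1) orbT.
  by lia.
by have := L_le (y - a1); lia.
Qed.

Theorem theorem8p3 (a b a' b' a'' b'' : nat)
    (ha : 2 <= a) (hb : 2 <= b) (hab : coprime a b)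
    (ha' : 0 < a' < a) (hb' : 0 < b' < b)
    (ha'' : 0 < a'' < a) (hb'' : 0 < b'' < b)
    (h' : a' * b = b' * a + 1) (h'' : b'' * a = a'' * b + 1)
    (hzeta : zeta_bijective a b)
    (hzeta' : zeta_bijective a' b')
    (hzeta'' : zeta_bijective a'' b'')
    (Q : (a + b).-tuple bool)
    (Q' : (a' + b').-tuple bool)
    (Q'' : (a'' + b'').-tuple bool)
    (hQ : Q \in dyck_paths a b)
    (hlevel1 : (b', a') \in lattice_points Q)
    (hQ' : Q' \in dyck_paths a' b')
    (hQ'' : Q'' \in dyck_paths a'' b'')
    (hcat : tval Q = tval Q' ++ tval Q'') :
  [/\ (forall x y, x < b' -> y < a' ->
         rotated_diagram a b (bounded_partition (chi a b Q)) (x, y)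
         = rotated_diagram a' b' (bounded_partition (chi a' b' Q')) (x, y)),
      (forall x y, b' <= x < b -> a' <= y < a ->
         rotated_diagram a b (bounded_partition (chi a b Q)) (x, y)
         = rotated_diagram a'' b'' (bounded_partition (chi a'' b'' Q''))
             (x - b', y - a'))
    & (forall x y, x < b -> y < a ->
         ~~ ((x < b') && (y < a')) -> ~~ ((b' <= x) && (a' <= y)) ->
         rotated_diagram a b (bounded_partition (chi a b Q)) (x, y)
         = below_diagonal a b (x, y))].
Proof.
have [a1_gt0 a1_lt] := andP ha'; have [b1_gt0 b1_lt] := andP hb'.
have [a2_gt0 a2_lt] := andP ha''; have [b2_gt0 b2_lt] := andP hb''.
(* The two determinants determine a = a' + a'' and b = b' + b''. *)
have cross : (a' + a'') * b = (b' + b'') * a by lia.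
have ea : a = a' + a''.
  have : a %| a' + a'' by rewrite -(Gauss_dvdl _ hab) cross dvdn_mull.
  by case/dvdnP => q; case: q => [|[|q]]; nia.
have eb : b = b' + b'' by nia.
subst a b.
have det : a' * b'' = b' * a'' + 1 by lia.
have co1 : coprime a' b'.
  apply/eqP; have : gcdn a' b' %| 1.
    rewrite -(dvdn_addr _ (_ : gcdn a' b' %| b' * a'')); last by rewrite dvdn_mulr ?dvdn_gcdr.
    by rewrite -det dvdn_mulr ?dvdn_gcdl.
  by rewrite dvdn1 => /eqP.
have co2 : coprime a'' b''.
  apply/eqP; have : gcdn a'' b'' %| 1.
    rewrite -(dvdn_addr _ (_ : gcdn a'' b'' %| b' * a'')); last by rewrite dvdn_mull ?dvdn_gcdl.
    by rewrite -det dvdn_mull ?dvdn_gcdr.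
  by rewrite dvdn1 => /eqP.
have [P1D P1E] := zeta_invK _ _ _ hzeta' hQ'.
have [P2D P2E] := zeta_invK _ _ _ hzeta'' hQ''.
move: (zeta_inv a' b' Q') (zeta_inv a'' b'' Q'') P1D P1E P2D P2E => P1 P2 P1D P1E P2D P2E.
have D1 := elimT (dyckP _ _ _) P1D; have D2 := elimT (dyckP _ _ _) P2D.
have [A1 [B [eP1 top]]] := max_prefix a' b' P1.
have [A eA] : exists A, A1 = rcons A true.
  have [q1 [q2 [eq pos]]] := dyck_positive_level _ _ _ a1_gt0 b1_gt0 D1.
  have pos1 := lt_le_trans pos (top _ _ eq).
  case: (lastP A1) eP1 top pos1 => [|A s] eP1 top pos1.
    by move: pos1; rewrite endpoint0 level0 ltxx.
  case: s eP1 top {pos1} => eP1 top; first by exists A.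
  have := top A (false :: B); rewrite -cat_rcons => /(_ eP1).
  by rewrite endpoint_rcons (level_step _ _ false); lia.
subst A1; rewrite eP1 in D1 top.
have D := insertion_dyck _ _ _ _ _ _ _ a1_gt0 b1_gt0 a2_gt0 b2_gt0 det co1 co2 D1 D2 top hab.
have szP := size_dyck _ _ _ D.
pose P : (a' + a'' + (b' + b'')).-tuple bool := Tuple (introT eqP szP).
have PD : P \in dyck_paths (a' + a'') (b' + b'') by apply/dyckP.
have PE : zeta (a' + a'') (b' + b'') P = Q.
  apply: zeta_eq => //; first by rewrite addn_gt0 a1_gt0.
  rewrite [tval P]/= insertion_zeta // -eP1 hcat bounded_partition_cat.
  rewrite -!bounded_partition_zeta // P1E P2E.
  by have [[+ _] _] := elimT (dyckP _ _ _) hQ'; rewrite /= add0n => ->.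
have [s [s1 s2 s3]] :=
  insertion_conjugate_lengths _ _ _ _ _ _ _ a1_gt0 b1_gt0 a2_gt0 b2_gt0 det co1 co2 D1 D2 top hab.
rewrite -eP1 in s1.
have lE : bounded_partition (chi (a' + a'') (b' + b'') Q) =
    [seq b'' + x | x <- sort geq s] ++ (b'' - 1) :: bounded_partition (chi a'' b'' Q'').
  rewrite -PE -P2E !bounded_partition_chi ?addn_gt0 ?a1_gt0 ?b1_gt0 //.
  symmetry; apply: sort_geq_eq; last first.
    rewrite perm_sym; apply: perm_trans s3 _; apply: perm_cat.
      by rewrite perm_map // perm_sym perm_sort.
    by rewrite perm_cons perm_sym perm_sort.
  apply: sorted_geq_cat.
  - rewrite sorted_map; apply: sub_sorted (sorted_sort_geq _) => x y /=.
    by rewrite leq_add2l.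
  - rewrite -cat1s; apply: sorted_geq_cat => //; first exact: sorted_sort_geq.
    by move=> x y /[!inE] /eqP ->; rewrite mem_sort => /s2.
  move=> _ y /mapP[x _ ->]; rewrite inE mem_sort => yl.
  apply: leq_trans (leq_addr x b''); case/orP: yl => [/eqP ->|/s2 yl].
    exact: leq_subr.
  exact: leq_trans yl (leq_subr _ _).
have l1E : bounded_partition (chi a' b' Q') = rcons (sort geq s) 0.
  rewrite -P1E bounded_partition_chi //; symmetry; apply: sort_geq_eq.
    rewrite -cats1; apply: sorted_geq_cat => //; first exact: sorted_sort_geq.
    by move=> x y _ /[!inE] /eqP ->.
  rewrite perm_sym; apply: perm_trans s1 _.
  by rewrite -perm_rcons perm_sym -!cats1 perm_cat2r perm_sort.
have szs : (size s).+1 = a'.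
  rewrite -(size_north_departures _ _ _ D1) -eP1.
  by have := perm_size s1; rewrite /= !size_map.
have l2_le j : nth 0 (bounded_partition (chi a'' b'' Q'')) j <= b'' - 1.
  rewrite -P2E bounded_partition_chi //.
  have [lt|ge] := ltnP j (size (sort geq (conjugate_lengths a'' b'' P2))).
    by apply: s2; rewrite -(mem_sort geq) mem_nth.
  by rewrite nth_default.
rewrite lE l1E; apply: glued_diagram => //.
by rewrite size_sort.
Qed.
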